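(* Let $G$ be a planar graph that contains no kites and has maximum degree $\Delta(G)\geq 9$. Then $\chi'_l(G)=\Delta(G)$.
   Context: All graphs are finite and without loops or multiple edges. $\Delta(G)$ denotes the maximum degree of $G$. A kite is a subgraph formed by two (distinct) 3-cycles that share an edge; ''contains no kites'' means that no two distinct 3-cycles of $G$ share an edge. The list edge chromatic number $\chi'_l(G)$ is the least integer $k$ such that, for every assignment $L$ of a list $L(e)$ of colors to each edge $e\in E(G)$ with $|L(e)|\geq k$ for all $e$, one can choose for each edge $e$ a color from $L(e)$ so that any two distinct edges sharing an endpoint receive different colors. *)

(* Defs.v *)
From mathcomp Require Import all_boot all_order all_algebra finmap.
From mathcomp Require Import all_classical all_reals all_analysis.

Set Implicit Arguments.
Unset Strict Implicit.
Unset Printing Implicit Defensive.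

Import Order.TTheory GRing.Theory Num.Theory.
Import numFieldNormedType.Exports.

Record sgraph := SGraph {
  vertex :> finType;
  adj : rel vertex;
  adj_sym : symmetric adj;
  adj_irrefl : irreflexive adj }.

Definition edge_set (G : sgraph) : {set {set G}} :=
  [set E : {set G} | [exists x : G, [exists y : G,
     adj x y && (E == [set x; y]%SET)]]]%SET.

Definition edge (G : sgraph) : finType := {E : {set G} | E \in edge_set G}.

Definition max_degree (G : sgraph) : nat :=
  \max_(x : G) #|[set y : G | adj x y]%SET|.

(* In a simple graph a 3-cycle is determined by its vertex set, and its edges
   are the edges of the graph contained in that set. *)
Definition triangles (G : sgraph) : {set {set G}} :=
  [set A : {set G} | (#|A| == 3) &&
     [forall x in A, forall y in A, (x != y) ==> adj x y]]%SET.

Definition kite_free (G : sgraph) : Prop :=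
  forall A B : {set G}, A \in triangles G -> B \in triangles G -> A != B ->
  ~ exists e : edge G, (val e \subset A) && (val e \subset B).

Section Planarity.
Local Open Scope classical_set_scope.
Local Open Scope ring_scope.

(* The plane is R * R, whose product (max-norm) topology is the Euclidean one;
   arcs are arbitrary injective continuous images of [0, 1]. *)
Definition is_arc (R : realType) (f : R -> R * R) : Prop :=
  {within `[0, 1], continuous f} /\ {in `[0, 1] &, injective f}.

Definition is_plane_drawing (R : realType) (G : sgraph)
    (p : G -> R * R) (g : edge G -> R -> R * R) : Prop :=
  [/\ injective p,
      forall e, is_arc (g e),
      forall e, exists x y : G,
        [/\ val e = [set x; y]%SET, g e 0 = p x & g e 1 = p y],
      forall e (x : G) (t : R), t \in `]0, 1[ -> g e t <> p x
    & forall e f : edge G, e != f -> forall s t : R,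
        s \in `]0, 1[ -> t \in `]0, 1[ -> g e s <> g f t].

Definition planar (R : realType) (G : sgraph) : Prop :=
  exists (p : G -> R * R) (g : edge G -> R -> R * R), is_plane_drawing p g.

End Planarity.

Definition proper_edge_coloring (G : sgraph) (C : Type) (c : edge G -> C) :
    Prop :=
  forall (e f : edge G) (x : G),
    e != f -> x \in val e -> x \in val f -> c e <> c f.

Definition edge_choosable (G : sgraph) (k : nat) : Prop :=
  forall (C : choiceType) (L : edge G -> {fset C}),
    (forall e, k <= #|` L e|) ->
    exists c : edge G -> C,
      (forall e, c e \in L e) /\ proper_edge_coloring c.

Lemma edge_choosable_card (G : sgraph) : edge_choosable G #|edge G|.
Proof.
move=> C L hL.
have [e0 _|noe] := pickP (@predT (edge G)); last first.
  have F (e : edge G) : False by have := noe e.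
  by exists (fun e => False_rect C (F e)); split => e; case: (F e).
have [x0 _] : exists x0, x0 \in L e0.
  have /fset0Pn[x xL] : L e0 != fset0.
    by rewrite -cardfs_gt0; apply: leq_trans (hL e0); apply/card_gt0P; exists e0.
  by exists x.
suff [c [cL cI]] : exists c : edge G -> C,
    {in enum (edge G), forall e, c e \in L e} /\
    {in enum (edge G) &, injective c}.
  exists c; split=> [e|e f z /eqP nef _ _ /cI]; first by apply: cL; rewrite mem_enum.
  by rewrite !mem_enum => /(_ isT isT).
have : size (enum (edge G)) <= #|edge G| by rewrite -cardE.
elim: (enum _) (enum_uniq (edge G)) => [|e s IH] /=.
  by move=> _ _; exists (fun=> x0); split.
move=> /andP[es us] hs; have [c [cL cI]] := IH us (ltnW hs).
have /fset0Pn[x] : (L e `\` [fset y in map c s] != fset0)%fset.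
  rewrite -cardfs_gt0 cardfsD subn_gt0.
  apply: leq_ltn_trans (leq_trans hs (hL e)).
  apply: leq_trans (fsubset_leq_card (fsubsetIr _ _)) _.
  by rewrite card_fseq -(size_map c s) size_undup.
rewrite in_fsetD inE => /andP[xs xL].
have xc f : f \in s -> x <> c f.
  by move=> fs xE; case/negP: xs; rewrite xE; apply: map_f.
exists (fun f => if f == e then x else c f); split.
  by move=> f; rewrite inE; case: eqP => [->//|_ /=]; apply: cL.
move=> f h; rewrite !inE; case: eqP => [->|_] /=; case: eqP => [->|_] //=.
- by move=> _ hin /(xc _ hin).
- by move=> hin _ /esym /(xc _ hin).
- exact: cI.
Qed.

Lemma edge_choosable_ex (G : sgraph) : exists k, `[< edge_choosable G k >].
Proof. by exists #|edge G|; apply/asboolP; exact: edge_choosable_card. Qed.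

Definition list_edge_chromatic_number (G : sgraph) : nat :=
  ex_minn (edge_choosable_ex G).

(* Main.v *)
Require Import Defs.
From mathcomp Require Import all_boot all_order all_algebra finmap.
From mathcomp Require Import all_classical all_reals all_analysis.
From mathcomp Require Import zify ring lra fintype finset.

Set Implicit Arguments.
Unset Strict Implicit.
Unset Printing Implicit Defensive.

Import Order.TTheory GRing.Theory Num.Theory.
Import numFieldNormedType.Exports.

(** Only the upper bound needs an argument: the edges at a vertex of maximum degree
D already require D colours.

Give each edge a list of at least D colours and suppose that some set A of
edges cannot be coloured; take A minimal.  Degrees are taken in A from now on.

Reducibility.  Removing a subset B of A leaves a colourable set, so B cannot be
coloured from what remains of its lists.  When B is bipartite with parts U and
W, all degrees in U are at most k, and each edge keeps at least
max(k, degree in B of its end in W) colours, B can be coloured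
([bipartite_list_colouring], a case of the theorem of Borodin, Kostochka and
Woodall, proved by Galvin's stable matchings).  With one edge this gives
d(x) + d(y) >= D + 2 for every edge xy ([critical_edge]).  With B the set of
edges meeting vertices of degree at most k, for k = 2 and k = 3, a peeling
argument attaches to each vertex of degree at most k a neighbour of degree at
least D + 2 - k, its master, such that no vertex is master of more than k - 1
vertices ([masters]).

Discharging.  Give a vertex of positive degree d the charge d - 4 and a triangle
the charge -1.  A triangle has at least two vertices of degree at least 6 and
takes 1/2 from each of them; a vertex of degree 3 takes 1 from its 3-master; a
vertex of degree 2 takes 1 from its 3-master and 1 from its 2-master.  As two
triangles never share an edge, a vertex is in at most d/2 triangles, and for
D >= 9 no charge ends up negative ([discharging]): with V vertices of positive
degree and T triangles, 2|A| >= 4V + T.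

Planarity.  Conversely 2|A| + 4 <= 4V + T for every nonempty set A of edges of a
planar graph.  This is what Euler's formula gives when all faces but triangles
have length at least four; it is obtained in the form of MacLane: the cycle space
of A over the field of two elements has dimension at least |A| - V + 1 and is spanned by
face boundaries, each edge lies in at most two boundaries, and a nonzero element
of the cycle space has at least four edges or is a triangle ([maclane_bound]).

The faces are obtained from arbitrary arcs without the Jordan curve theorem.
Cut every arc into thirds.  By compactness, the thirds that do not meet are
uniformly far apart, so sampling the arcs finely on a square grid replaces the
drawing by disjoint connected sets of grid cells, one for each vertex, with one
grid edge between them for each edge of the graph ([planar_grid_model]): the
graph is a minor of a grid.  In a grid, the winding number modulo 2 of a closed
walk around a grid face is the number of its edges below that face, and crossing
a grid edge changes it by the number of times that the walk uses this edge
([flux_walk]).  Grid faces around which all cycles of A have the same winding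
numbers are identified, and the resulting classes are the faces of A:
their boundaries span because winding numbers jump exactly at the edges of a
cycle ([cycles_bound]), and they are cycles because they are so locally, around
each grid cell ([faces_even]). *)

(** * List colouring of bipartite graphs *)

Lemma leq_card_bigcup (I T : finType) (X : {set I}) (F : I -> {set T}) :
  #|\bigcup_(i in X) F i| <= \sum_(i in X) #|F i|.
Proof.
elim/big_rec2: _ => [|i n A _ leA]; first by rewrite cards0.
by apply: leq_trans (leq_card_setU _ _) _; rewrite leq_add2l.
Qed.

(** The partial map h lets each u choose at most one w, which makes the
representatives of distinct elements of P distinct.  The proof is Rado's: as
long as some N w has two elements, one of them can be dropped, since two
violators of Hall's condition, one for each removal, would contradict the
condition for their union and for their intersection without w. *)
Lemma hall_marriage (W U : finType) (P : {set W}) (N : W -> {set U}) :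
  (forall Q : {set W}, Q \subset P -> #|Q| <= #|\bigcup_(w in Q) N w|) ->
  exists h : U -> option W,
    forall w, w \in P -> exists2 u, u \in N w & h u = Some w.
Proof.
have [n] := ubnP (\sum_w #|N w|).
elim: n N => // n IHn N leNn hallN.
have [/existsP[w /andP[wP Nw]]|/existsPn small] :=
    boolP [exists w, (w \in P) && (1 < #|N w|)]; last first.
  (* All the N w are singletons, and Hall's condition makes them distinct. *)
  exists (fun u => [pick w in P | u \in N w]) => w wP.
  have cN1 : #|N w| = 1.
    have := small w; rewrite wP /= -leqNgt => Nw.
    have := hallN [set w]; rewrite sub1set wP cards1 big_set1 => /(_ isT).
    by move=> Nw1; apply/eqP; rewrite eqn_leq Nw Nw1.
  have /cards1P[u Nu] : #|N w| == 1 by apply/eqP.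
  exists u; first by rewrite Nu set11.
  case: pickP => [w' /andP[w'P uw']|/(_ w)]; last by rewrite wP Nu set11.
  congr Some; apply/eqP/negPn/negP => ww'.
  have := hallN [set w'; w]; rewrite cards2 ww' subUset !sub1set wP w'P.
  move=> /(_ isT); rewrite leqNgt => /negP; apply; rewrite ltnS.
  rewrite [nat_of_bool _]/= -(cards1 u); apply: subset_leq_card; apply/subsetP => v.
  case/bigcupP => x; rewrite !inE => /orP[]/eqP-> //; last by rewrite Nu inE.
  have := small w'; rewrite w'P /= -leqNgt => Nw' vw'.
  by apply/eqP/(card_le1_eqP Nw').
have /card_gt1P[x [y [xN yN xy]]] := Nw.
pose N1 z v := if v == w then N w :\ z else N v.
have sub_N1 z v : N1 z v \subset N v.
  by rewrite /N1 /=; case: eqP => [->|//]; exact: subsetDl.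
have N1w z : N1 z w = N w :\ z by rewrite /N1 eqxx.
have N1v z v : v != w -> N1 z v = N v by rewrite /N1; case: eqP.
have lt_N1 z : z \in N w -> \sum_v #|N1 z v| < n.
  move=> zN; move: leNn; rewrite ltnS; apply: leq_trans.
  rewrite (bigD1 w) // [leqRHS](bigD1 w) //= N1w -addSn leq_add //.
    by rewrite [leqRHS](cardsD1 z) zN.
  by apply: leq_sum => v /N1v->.
have descend z : z \in N w ->
   (forall Q : {set W}, Q \subset P -> #|Q| <= #|\bigcup_(v in Q) N1 z v|) ->
  exists h : U -> option W,
    forall v, v \in P -> exists2 u, u \in N v & h u = Some v.
  move=> zN /(IHn _ (lt_N1 _ zN))[h hh]; exists h => v /hh[u uN hu].
  by exists u => //; apply: subsetP uN; apply: sub_N1.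
have viol z : z \in N w ->
  ~ (exists h : U -> option W,
    forall v, v \in P -> exists2 u, u \in N v & h u = Some v) ->
  exists Q : {set W}, [/\ Q \subset P, w \in Q
     & #|\bigcup_(v in Q) N1 z v| < #|Q|].
  move=> zN noh.
  have [/forall_inP ok|] := boolP [forall (Q : {set W} | Q \subset P),
       #|Q| <= #|\bigcup_(v in Q) N1 z v|].
    by case: noh; apply: descend zN ok.
  rewrite negb_forall => /existsP[Q]; rewrite negb_imply -ltnNge => /andP[QP ltQ].
  exists Q; split=> //; apply/negPn/negP => wQ.
  move: ltQ; rewrite ltnNge => /negP; apply.
  apply: leq_trans (hallN Q QP) _; rewrite (eq_bigr (N1 z)) // => v vQ.
  by rewrite N1v //; apply: contra wQ => /eqP <-.
apply: contrapT => noh.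
have [Q1 [Q1P wQ1 lt1]] := viol x xN noh.
have [Q2 [Q2P wQ2 lt2]] := viol y yN noh.
set P1 := \bigcup_(v in Q1) _ in lt1; set P2 := \bigcup_(v in Q2) _ in lt2.
have leU : #|Q1 :|: Q2| <= #|P1 :|: P2|.
  apply: leq_trans (hallN _ _) _; first by rewrite subUset Q1P.
  apply/subset_leq_card/bigcupsP => v vQ; apply/subsetP => u uv.
  have [vw|vw] := eqVneq v w.
    move: uv vQ; rewrite vw [in X in _ -> _ -> X]inE => uv _; have [ux|ux] := eqVneq u x.
      by apply/orP; right; apply/bigcupP; exists w; rewrite // N1w !inE uv ux xy /=.
    by apply/orP; left; apply/bigcupP; exists w; rewrite // N1w !inE uv ux.
  move: vQ; rewrite !inE => /orP[vQ|vQ]; apply/orP; [left|right];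
  by apply/bigcupP; exists v; rewrite // N1v.
have leI : #|Q1 :&: Q2| <= #|P1 :&: P2|.+1.
  rewrite (cardsD1 w) inE wQ1 wQ2 ltnS; apply: leq_trans (hallN _ _) _.
    by apply: subset_trans (subsetDl _ _) _; apply: subset_trans (subsetIl _ _) _.
  apply/subset_leq_card/bigcupsP => v; rewrite !inE => /and3P[vw v1 v2].
  apply/subsetP => u uv; rewrite inE.
  by apply/andP; split; apply/bigcupP; exists v; rewrite // N1v.
have := cardsUI Q1 Q2; have := cardsUI P1 P2; move: lt1 lt2 leU leI.
lia.
Qed.

Section BipartiteListColouring.

Variables (E U W : finType) (fu : E -> U) (fw : E -> W).

(** Edges of S prefer small values of ru at their U-end and of rw at their
W-end.  If the best edges at the vertices of U form a matching, it is stable.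
Otherwise two of them share a W-end, and the worse one, e2, can be ignored: any
edge that beats the better one, e1, can only do so at that W-end, hence beats
e2 too. *)
Lemma stable_matching (ru rw : E -> nat) (S : {set E}) :
  {in S &, forall e f, fu e = fu f -> ru e = ru f -> e = f} ->
  {in S &, forall e f, fw e = fw f -> rw e = rw f -> e = f} ->
  exists M : {set E}, [/\ M \subset S,
    {in M &, forall e f, e != f -> fu e != fu f /\ fw e != fw f}
  & forall e, e \in S -> e \notin M -> exists2 f, f \in M &
      (fu f == fu e) && (ru f < ru e) || (fw f == fw e) && (rw f < rw e)].
Proof.
have [n] := ubnP #|S|; elim: n S => // n IHn S leSn iu iw.
pose T := [set e in S | [forall f in S, (fu f == fu e) ==> (ru e <= ru f)]].
have minT e f : e \in T -> f \in S -> fu f = fu e -> ru e <= ru f.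
  by rewrite inE => /andP[_ /forall_inP/(_ f)] h fS fe; have := h fS; rewrite fe eqxx.
have TS e : e \in T -> e \in S by rewrite inE => /andP[].
have [/existsP[e1 /existsP[e2 /and5P[T1 T2 e12 w12 r12]]]|noclash] :=
  boolP [exists e1, [exists e2, [&& e1 \in T, e2 \in T, e1 != e2,
           fw e1 == fw e2 & rw e1 < rw e2]]].
  have sD e : e \in S :\ e2 -> e \in S by rewrite inE => /andP[].
  have [|e f /sD eS /sD fS|e f /sD eS /sD fS|M [MS mM dM]] := IHn (S :\ e2).
  - by move: leSn; rewrite (cardsD1 e2) TS.
  - exact: iu.
  - exact: iw.
  exists M; split=> //; first by apply: subset_trans MS (subsetDl _ _).
  move=> e eS eM; have [ee2|ne] := eqVneq e e2; last first.
    by apply: dM eM; rewrite !inE ne.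
  have [M1|M1] := boolP (e1 \in M).
    by exists e1 => //; rewrite ee2 w12 r12 orbT.
  have [|f fM] := dM e1 _ M1; first by rewrite !inE e12 TS.
  have fS : f \in S by apply: sD; apply: (subsetP MS).
  case/orP => /andP[/eqP fe lt1].
    by have := minT _ _ T1 fS fe; rewrite leqNgt lt1.
  by exists f => //; rewrite ee2 fe w12 (ltn_trans lt1 r12) orbT.
exists T; split.
- by apply/subsetP => e /TS.
- move=> e f eT fT ef; split; apply: contra ef => /eqP ef.
    apply/eqP/iu; rewrite ?TS //; apply/eqP.
    by rewrite eqn_leq !minT ?TS.
  move: noclash; rewrite negb_exists => /forallP clash.
  have lt0 a b : a \in T -> b \in T -> a != b -> fw a = fw b -> rw b <= rw a.
    move=> aT bT ab fab; have := clash a; rewrite negb_exists => /forallP/(_ b).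
    by rewrite aT bT ab fab eqxx /= -leqNgt.
  apply/idPn => ne; case/eqP: (ne); apply: iw; rewrite ?TS //; apply/eqP.
  by rewrite eqn_leq !lt0 // eq_sym.
- move=> e eS eT.
  pose f := [arg min_(f < e | (f \in S) && (fu f == fu e)) ru f].
  have : (f \in S) && (fu f == fu e) /\
     forall j, (j \in S) && (fu j == fu e) -> ru f <= ru j.
    by rewrite /f; case: arg_minnP; rewrite ?eS ?eqxx //; split.
  case=> /andP[fS /eqP fe] fmin; have fT : f \in T.
    rewrite inE fS; apply/forall_inP => j jS; apply/implyP => /eqP je.
    by apply: fmin; rewrite jS je fe eqxx.
  exists f => //; rewrite fe eqxx /= ltn_neqAle fmin ?eS ?eqxx // andbT orbC.
  apply/orP; right; apply: contra eT => /eqP rr.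
  by rewrite -(iu _ _ fS eS fe rr).
Qed.

(** Give a colour a to a stable matching among the edges whose list contains a:
each other such edge loses the colour a but also one of its better neighbours,
so that the hypothesis is preserved.  The map c0 provides colours outside S, as
C could otherwise be empty. *)
Lemma galvin_list_colouring (C : choiceType) (c0 : E -> C) (ru rw : E -> nat) (S : {set E})
    (L : E -> {fset C}) :
  {in S &, forall e f, fu e = fu f -> ru e = ru f -> e = f} ->
  {in S &, forall e f, fw e = fw f -> rw e = rw f -> e = f} ->
  (forall e, e \in S ->
     #|[set f in S | (fu f == fu e) && (ru f < ru e)]|
     + #|[set f in S | (fw f == fw e) && (rw f < rw e)]| < #|` L e|) ->
  exists c : E -> C, {in S, forall e, c e \in L e} /\
    {in S &, forall e f, e != f -> fu e = fu f \/ fw e = fw f -> c e <> c f}.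
Proof.
have [n] := ubnP #|S|; elim: n S L => // n IHn S L leSn iu iw hL.
have [->|/set0Pn[e0 e0S]] := eqVneq S finset.set0.
  by exists c0; split=> [e|e f]; rewrite inE.
have /fset0Pn[a aL] : L e0 != fset0.
  by rewrite -cardfs_gt0; apply: leq_ltn_trans (hL _ e0S).
pose Sa := [set e in S | a \in L e].
have SaS e : e \in Sa -> e \in S by rewrite inE => /andP[].
have [||M [MSa mM dM]] := @stable_matching ru rw Sa.
- by move=> e f /SaS eS /SaS fS; apply: iu.
- by move=> e f /SaS eS /SaS fS; apply: iw.
have MS e : e \in M -> e \in S by move/(subsetP MSa)/SaS.
have [m0 m0M] : exists m, m \in M.
  have [?|n0] := boolP (e0 \in M); first by exists e0.
  by have [|f fM _] := dM _ _ n0; [rewrite inE e0S | exists f].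
have D e : e \in S :\: M -> e \in S by rewrite inE => /andP[].
have [||||c [cL cP]] := IHn (S :\: M) (fun e => L e `\ a)%fset.
- rewrite -ltnS; apply: leq_trans leSn; rewrite ltnS; apply: proper_card.
  apply/properP; split; first exact: subsetDl.
  by exists m0; rewrite ?MS // inE m0M.
- by move=> e f /D eS /D fS; apply: iu.
- by move=> e f /D eS /D fS; apply: iw.
- move=> e eSM; have eS := D _ eSM.
  have := hL _ eS; rewrite (cardfsD1 a (L e)).
  set ku := #|[set f in S | (fu _ == _) && _]|.
  set kw := #|[set f in S | (fw _ == _) && _]|.
  set ku' := #|[set f in S :\: M | (fu _ == _) && _]|.
  set kw' := #|[set f in S :\: M | (fw _ == _) && _]|.
  have lu : ku' <= ku.
    by apply/subset_leq_card/subsetP => f; rewrite !inE => /andP[/andP[_ ->]].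
  have lw : kw' <= kw.
    by apply/subset_leq_card/subsetP => f; rewrite !inE => /andP[/andP[_ ->]].
  have [ae|ae] := boolP (a \in L e); last by rewrite add0n; lia.
  have [||f fM] := dM e; [by rewrite inE eS | by move: eSM; rewrite inE => /andP[]|].
  case/orP=> ff.
    have : ku' < ku; last by lia.
    apply: proper_card; apply/properP; split.
      by apply/subsetP => g; rewrite !inE => /andP[/andP[_ ->]].
    by exists f; rewrite !inE ?MS // fM.
  have : kw' < kw; last by lia.
  apply: proper_card; apply/properP; split.
    by apply/subsetP => g; rewrite !inE => /andP[/andP[_ ->]].
  by exists f; rewrite !inE ?MS // fM.
have cLD e : e \in S -> e \notin M -> c e \in L e /\ c e != a.
  move=> eS eM; have := cL e; rewrite inE eS eM => /(_ isT).
  by rewrite in_fsetD1 => /andP[].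
exists (fun e => if e \in M then a else c e); split.
  move=> e eS; case: ifPn => [/(subsetP MSa)|/(cLD _ eS)[]//].
  by rewrite inE => /andP[].
move=> e f eS fS ef adj; case: ifPn => eM; case: ifPn => fM.
- by have [/eqP ? /eqP ?] := mM _ _ eM fM ef; case: adj.
- by have [_ /eqP ca] := cLD _ fS fM => /esym.
- by have [_ /eqP ca] := cLD _ eS eM.
- by apply: cP => //; rewrite inE ?eM ?fM.
Qed.

Definition at_u (S : {set E}) x := [set e in S | fu e == x].
Definition at_w (S : {set E}) y := [set e in S | fw e == y].

(** The edges chosen for the W-ends of degree greater than k come from Hall's
theorem: k.+1 times the number of these ends is at most the number of edges at
them, which is at most k.+1 times the number of their neighbours.  Vertices of U
left unmatched choose any edge. *)
Lemma representatives (k : nat) (S : {set E}) :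
  (forall x, #|at_u S x| <= k.+1) ->
  exists R : {set E}, [/\ R \subset S,
    {in R &, forall e f, fu e = fu f -> e = f},
    forall e, e \in S -> exists2 f, f \in R & fu f = fu e
  & forall y, k < #|at_w S y| -> exists2 f, f \in R & fw f = y].
Proof.
move=> degu; pose P := [set y | k < #|at_w S y|].
pose N y := [set fu e | e in at_w S y].
have [|h hP] := @hall_marriage W U P N.
  move=> Q QP; rewrite -(leq_pmul2l (ltn0Sn k)).
  apply: (@leq_trans #|[set e in S | fw e \in Q]|).
    rewrite (eq_card (B := mem (\bigcup_(y in Q) at_w S y))); last first.
      move=> e; rewrite inE; apply/andP/bigcupP => [[eS eQ]|[y yQ]].
        by exists (fw e); rewrite // inE eS eqxx.
      by rewrite inE => /andP[eS /eqP->].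
    rewrite (card_partition (P := [set at_w S y | y in Q])).
      rewrite big_imset /=; last first.
        move=> y z yQ zQ yz; have := subsetP QP y yQ; rewrite inE => lt_k.
        have /card_gt0P[e] : 0 < #|at_w S y| by apply: leq_ltn_trans lt_k.
        move=> ey; have := ey; rewrite yz; move: ey.
        by rewrite !inE => /andP[_ /eqP<-] /andP[_ /eqP<-].
      rewrite mulnC -sum_nat_const; apply: leq_sum => y /(subsetP QP).
      by rewrite inE.
    apply/and3P; split.
    - by rewrite /cover big_imset_idem //=; exact: setUid.
    - apply/trivIsetP => A B /imsetP[y yQ ->] /imsetP[z zQ ->] AB.
      apply/pred0P => e /=; apply/negP => /andP[]; rewrite !inE.
      by move=> /andP[_ /eqP ey] /andP[_ /eqP ez]; rewrite -ey ez eqxx in AB.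
    - apply/negP => /imsetP[y yQ /esym/eqP]; rewrite -cards_eq0 => /eqP c0.
      by have := subsetP QP y yQ; rewrite inE c0.
  apply: (@leq_trans #|\bigcup_(x in \bigcup_(y in Q) N y) at_u S x|).
    apply/subset_leq_card/subsetP => e; rewrite inE => /andP[eS eQ].
    apply/bigcupP; exists (fu e); last by rewrite inE eS eqxx.
    apply/bigcupP; exists (fw e) => //; apply/imsetP; exists e => //.
    by rewrite inE eS eqxx.
  apply: leq_trans (leq_card_bigcup _ _) _.
  by rewrite mulnC -sum_nat_const; apply: leq_sum.
pose r x := if h x is Some y then
    if [pick e in S | (fu e == x) && (fw e == y)] is Some e then Some e
    else [pick e in S | fu e == x]
  else [pick e in S | fu e == x].
have r_some e : e \in S -> exists2 f, r (fu e) = Some f & f \in S /\ fu f = fu e.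
  move=> eS.
  have pk : exists2 f, [pick f in S | fu f == fu e] = Some f
      & f \in S /\ fu f = fu e.
    case: pickP => [f /andP[fS /eqP fe]|/(_ e)]; last by rewrite eS eqxx.
    by exists f.
  rewrite /r; case: (h _) => // y.
  by case: (pickP (fun f => _ && (_ && _))) => // f /and3P[fS /eqP fe _]; exists f.
exists [set e in S | r (fu e) == Some e]; split.
- by apply/subsetP => e; rewrite inE => /andP[].
- move=> e f; rewrite !inE => /andP[_ /eqP re] /andP[_ /eqP rf] ef.
  by move: re; rewrite ef rf => -[].
- move=> e /r_some[f rf [fS fe]]; exists f => //.
  by rewrite inE fS fe rf eqxx.
- move=> y ky; have [|x] := hP y; first by rewrite inE.
  case/imsetP => e; rewrite inE => /andP[eS /eqP ey] -> hx.
  have [f rf [fS fe]] := r_some _ eS.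
  exists f; first by rewrite inE fS fe rf eqxx.
  move: rf; rewrite /r hx.
  case: pickP => [g /and3P[_ _ /eqP gy] [<-//]|/(_ e)].
  by rewrite eS eqxx ey eqxx.
Qed.

(** Induction on k.  The representatives R become the best edges at their U-ends
and the worst ones at their W-ends.  The remaining edges get one better
neighbour in U, which is paid for by k, or by the degree of a W-end that lies on
an edge of R. *)
Lemma preferences (k : nat) (S : {set E}) :
  (forall x, #|at_u S x| <= k) ->
  exists ru rw : E -> nat,
  [/\ {in S &, forall e f, fu e = fu f -> ru e = ru f -> e = f},
      {in S &, forall e f, fw e = fw f -> rw e = rw f -> e = f}
    & forall e, e \in S ->
       #|[set f in S | (fu f == fu e) && (ru f < ru e)]|
       + #|[set f in S | (fw f == fw e) && (rw f < rw e)]|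
         < maxn k #|at_w S (fw e)|].
Proof.
elim: k S => [|k IHk] S degu.
  have S0 e : e \in S -> False.
    move=> eS; have := degu (fu e); rewrite leqn0 cards_eq0 => /eqP/setP/(_ e).
    by rewrite !inE eS eqxx.
  by exists (fun=> 0), (fun=> 0); split=> [e f /S0|e f /S0|e /S0].
have [R [RS Ru Rtot Rw]] := representatives degu.
have RinS e : e \in R -> e \in S by move/(subsetP RS).
pose S' := S :\: R.
have [x|ru [rw [iu iw le_pref]]] := IHk S'.
  have [-> |/set0Pn[e]] := eqVneq (at_u S' x) finset.set0; first by rewrite cards0.
  rewrite !inE => /andP[/andP[eR eS] /eqP ex].
  have [f fR fx] := Rtot _ eS.
  rewrite -ltnS; apply: leq_trans (degu x); apply: proper_card.
  apply/properP; split; first by apply/subsetP => g; rewrite !inE => /andP[/andP[_ ->]].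
  by exists f; rewrite !inE ?RinS ?fR //= fx ex.
pose ru' e := if e \in R then 0 else (ru e).+1.
pose big := (\max_f rw f).+1.
have rw_big e : rw e < big by rewrite ltnS; exact: leq_bigmax.
pose rw' e := if e \in R then big + enum_rank e else rw e.
have inS' e : e \in S -> e \notin R -> e \in S' by rewrite inE => -> ->.
exists ru', rw'; split.
- move=> e f eS fS ef; rewrite /ru'; case: ifPn => eR; case: ifPn => fR //.
    by move=> _; apply: Ru.
  by case; apply: iu; rewrite ?inS'.
- move=> e f eS fS ef; rewrite /rw'; case: ifPn => eR; case: ifPn => fR.
  + by move/addnI/ord_inj/enum_rank_inj.
  + by have := rw_big f; lia.
  + by have := rw_big e; lia.
  + by apply: iw; rewrite ?inS'.
move=> e eS; have [eR|eR] := boolP (e \in R).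
  rewrite (_ : [set f in S | (fu f == fu e) && _] = finset.set0) ?cards0 ?add0n.
    rewrite leq_max; apply/orP; right; apply: proper_card; apply/properP; split.
      by apply/subsetP => f; rewrite !inE => /andP[-> /andP[->]].
    by exists e; rewrite !inE ?eS ?eqxx ?ltnn ?andbF.
  by apply/setP => f; rewrite !inE /ru' eR ltn0 !andbF.
have eS' := inS' _ eS eR.
have := le_pref _ eS'.
set a := (X in X + _ < _ -> _); set b := (X in _ + X < _ -> _).
set a' := (X in _ -> X + _ < _); set b' := (X in _ -> _ + X < _).
have le_a : a' <= a.+1.
  have [f fR fe] := Rtot _ eS.
  apply: leq_trans (_ : #|f |: [set g in S' | (fu g == fu e) && (ru g < ru e)]| <= _).
    apply/subset_leq_card/subsetP => g; rewrite !inE /ru' (negPf eR).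
    case/and3P=> gS /eqP ge; case: ifPn => gR ltg.
      by rewrite (Ru g f) ?eqxx // ge fe.
    by rewrite gS ge eqxx -ltnS ltg orbT.
  by rewrite cardsU1; case: (_ \notin _).
have le_b : b' <= b.
  apply/subset_leq_card/subsetP => g; rewrite !inE /rw' (negPf eR).
  case/and3P=> gS ->; case: ifPn => gR; last by rewrite gS.
  by have := rw_big e; lia.
(* Either the W-end has small degree, and k pays, or it loses an edge of R. *)
have lt_d : #|at_w S' (fw e)| < maxn k.+1 #|at_w S (fw e)|.
  have le_d : #|at_w S' (fw e)| <= #|at_w S (fw e)|.
    by apply/subset_leq_card/subsetP => g; rewrite !inE => /andP[/andP[_ ->]].
  rewrite leq_max; have [small|big_d] := leqP #|at_w S (fw e)| k.
    by rewrite ltnS (leq_trans le_d).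
  apply/orP; right; have [f fR fe] := Rw _ big_d.
  apply: proper_card; apply/properP; split.
    by apply/subsetP => g; rewrite !inE => /andP[/andP[_ ->]].
  by exists f; rewrite !inE ?RinS ?fR //= fe.
by move: le_a le_b lt_d; lia.
Qed.

Lemma bipartite_list_colouring (C : choiceType) (c0 : E -> C) (k : nat)
    (S : {set E}) (L : E -> {fset C}) :
  (forall x, #|at_u S x| <= k) ->
  (forall e, e \in S -> maxn k #|at_w S (fw e)| <= #|` L e|) ->
  exists c : E -> C, {in S, forall e, c e \in L e} /\
    {in S &, forall e f, e != f -> fu e = fu f \/ fw e = fw f -> c e <> c f}.
Proof.
move=> degu hL; have [ru [rw [iu iw pref]]] := preferences degu.
apply: (galvin_list_colouring c0 iu iw) => e eS.
exact: leq_trans (pref _ eS) (hL _ eS).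
Qed.

End BipartiteListColouring.

(** * Reducible configurations *)

Section CriticalEdgeSets.

Variable G : sgraph.
Implicit Types (A B : {set edge G}) (e f : edge G) (x y u v w : G).

Lemma edge_ends e : exists x y, [/\ x != y, adj x y & val e = [set x; y]].
Proof.
case: e => E /=; rewrite inE => /existsP[x /existsP[y /andP[xy /eqP ->]]].
exists x, y; split=> //; apply: contraTneq xy => ->.
by rewrite adj_irrefl.
Qed.

(** The default value x is never taken when x is an end of e. *)
Definition other e x := odflt x [pick y in val e | y != x].

Lemma otherP e x : x \in val e -> x != other e x /\ val e = [set x; other e x].
Proof.
have [a [b [ab _ ve]]] := edge_ends e; rewrite /other => xe.
case: pickP => [y|]; rewrite [odflt _ _]/=.
  rewrite ve !inE => /andP[ye yx]; rewrite eq_sym yx; split=> //.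
  move: xe ye yx; rewrite ve !inE.
  by move=> /orP[]/eqP-> /orP[]/eqP->; rewrite ?eqxx // setUC.
move: xe; rewrite ve !inE => /orP[]/eqP->; [move/(_ b)|move/(_ a)];
by rewrite !inE eqxx ?orbT ?ab // eq_sym ab.
Qed.

Lemma edge_inj_other e f x : x \in val e -> x \in val f ->
  other e x = other f x -> e = f.
Proof.
by move=> /otherP[_ ve] /otherP[_ vf] ef; apply: val_inj; rewrite ve vf ef.
Qed.

Lemma mem_other e x : x \in val e -> other e x \in val e.
Proof. by move=> /otherP[_ ->]; rewrite !inE eqxx orbT. Qed.

Definition deg A x := #|[set e in A | x \in val e]|.

Lemma degS A B x : B \subset A -> deg B x <= deg A x.
Proof.
move=> BA; apply/subset_leq_card/subsetP => e; rewrite !inE => /andP[/(subsetP BA) ->].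
by [].
Qed.

Lemma degD A B x : B \subset A -> deg (A :\: B) x = deg A x - deg B x.
Proof.
move=> BA; rewrite /deg.
have -> : [set e in A :\: B | x \in val e]
    = [set e in A | x \in val e] :\: [set e in B | x \in val e].
  by apply/setP => e; rewrite !inE; case: (e \in B); case: (e \in A); case: (x \in _).
rewrite cardsD; congr (_ - _); congr #|pred_of_set _|; apply/setIidPr.
by apply/subsetP => e; rewrite !inE => /andP[/(subsetP BA) ->].
Qed.

Variables (C : choiceType) (L : edge G -> {fset C}) (D : nat).

Definition list_colourable A := exists c : edge G -> C,
  (forall e, e \in A -> c e \in L e) /\
  (forall e f x, e \in A -> f \in A -> e != f -> x \in val e -> x \in val f ->
     c e <> c f).

Definition critical A := ~ list_colourable A /\
  forall B, B \proper A -> list_colourable B.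

Hypothesis leDL : forall e, D <= #|` L e|.

(** Colour the edges outside B first.  An edge of B then loses at most as many
colours as there are edges of A outside B at its two ends, and what remains is
enough to colour the bipartite graph B. *)
Lemma no_alternator k A B (fu fw : edge G -> G) :
  critical A -> B \subset A -> B != finset.set0 ->
  {in B, forall e, val e = [set fu e; fw e]} ->
  {in B &, forall e f, fu e != fw f} ->
  (forall x, #|at_u fu B x| <= k) ->
  {in B, forall e, (deg A (fu e) - deg B (fu e)) + (deg A (fw e) - deg B (fw e))
     + maxn k (deg B (fw e)) <= D} -> False.
Proof.
move=> [ncol colP] BA /set0Pn[e0 e0B] vB sep degu bound; apply: ncol.
have [|c [cL cP]] := colP (A :\: B).
  apply/properP; split; first exact: subsetDl.
  by exists e0; rewrite ?(subsetP BA) // inE e0B.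
pose N e := [set f in A :\: B | fu e \in val f] :|: [set f in A :\: B | fw e \in val f].
pose F e := [fset y in [seq c f | f in N e]]%fset.
have [x|e eB|c' [cL' cP']] :=
    @bipartite_list_colouring _ _ _ fu fw C c k B (fun e => L e `\` F e)%fset.
- exact: degu.
- have -> : #|at_w fw B (fw e)| = deg B (fw e).
    apply: eq_card => f; rewrite !inE; have [fB|//] := boolP (f \in B).
    by rewrite vB // !inE [fw e == fu f]eq_sym (negPf (sep _ _ fB eB)) eq_sym.
  rewrite cardfsD leq_subRL; last first.
    exact: fsubset_leq_card (fsubsetIl _ _).
  apply: leq_trans (leDL e); apply: leq_trans (bound e eB); rewrite leq_add2r.
  apply: leq_trans (fsubset_leq_card (fsubsetIr _ _)) _.
  rewrite card_fseq; apply: leq_trans (size_undup _) _; rewrite size_image.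
  apply: leq_trans (leq_card_setU _ _) _.
  by rewrite -!degD.
have cF e f x : e \in B -> f \in A :\: B -> x \in val e -> x \in val f -> c' e <> c f.
  move=> eB fAB; rewrite vB // => xe xf cef.
  have := cL' e eB; rewrite in_fsetD => /andP[/negP + _]; apply.
  rewrite cef in_fset; apply/imageP; exists f => //.
  by move: fAB xe xf; rewrite !inE => -> /orP[]/eqP-> ->; rewrite ?orbT.
exists (fun e => if e \in B then c' e else c e); split.
  move=> e eA; case: ifPn => eB; last by apply: cL; rewrite inE eB.
  by have := cL' e eB; rewrite in_fsetD => /andP[].
move=> e f x eA fA ef xe xf; case: ifPn => eB; case: ifPn => fB.
- apply: cP' => //; move: xe xf; rewrite !vB // !inE.
  move=> /orP[]/eqP-> /orP[]/eqP xf; [by left| | |by right].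
    by have := sep _ _ eB fB; rewrite xf eqxx.
  by have := sep _ _ fB eB; rewrite xf eqxx.
- by apply: cF xe xf => //; rewrite inE fB.
- by apply/nesym; apply: cF xf xe => //; rewrite inE eB.
- by apply: cP xe xf; rewrite ?inE ?eB ?fB.
Qed.

Lemma deg_gt0 A e x : e \in A -> x \in val e -> 0 < deg A x.
Proof. by move=> eA xe; apply/card_gt0P; exists e; rewrite inE eA. Qed.

(** The case where B consists of the single edge e, and k = 1. *)
Lemma critical_edge A e x : critical A -> e \in A -> x \in val e ->
  D + 2 <= deg A x + deg A (other e x).
Proof.
move=> critA eA xe; have [xo ve] := otherP xe.
have oe := mem_other xe.
rewrite leqNgt; apply/negP => lt_sum.
have deg1 y : y \in val e -> deg [set e] y = 1.
  move=> ye; rewrite /deg -[RHS](cards1 e); apply: eq_card => f; rewrite !inE.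
  by case: eqP => // ->.
apply: (@no_alternator 1 A [set e] (fun=> x) (fun=> other e x)) => //.
- by rewrite sub1set.
- by apply/set0Pn; exists e; rewrite set11.
- by move=> f /set1P->.
- move=> y; rewrite -(cards1 e); apply/subset_leq_card/subsetP => f.
  by rewrite !inE => /andP[].
- move=> f _; rewrite !deg1 //.
  have := deg_gt0 eA xe; have := deg_gt0 eA oe; move: lt_sum; lia.
Qed.

(** Let U' be a set of vertices of degree at most k; they are pairwise
nonadjacent by [critical_edge].  The edges meeting U' do not form a reducible
configuration, so some vertex w of large degree has between 1 and k - 1
neighbours in U'.  It becomes their master, and the argument is repeated with
the other vertices of U', none of which is adjacent to w. *)
Lemma masters k A : 0 < k -> critical A -> (forall x, deg A x <= D) -> k.*2 <= D.+1 ->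
  exists m : G -> G,
   (forall u, 0 < deg A u <= k -> D + 2 <= deg A (m u) + k) /\
   (forall w, #|[set u | (0 < deg A u <= k) && (m u == w)]| <= k.-1).
Proof.
move=> k0 critA leD kD.
suff peel (U' : {set G}) : U' \subset [set u | 0 < deg A u <= k] ->
    exists m : G -> G,
   (forall u, u \in U' ->
      D + 2 <= deg A (m u) + k /\ exists2 e, e \in A & val e = [set u; m u]) /\
   (forall w, #|[set u in U' | m u == w]| <= k.-1).
  have [m [m1 m2]] := peel _ (subxx _).
  exists m; split=> [u hu|w]; first by have [|] := m1 u; rewrite ?inE.
  apply: leq_trans (m2 w); apply/subset_leq_card/subsetP => u.
  by rewrite !inE.
have [n] := ubnP #|U'|; elim: n U' => // n IHn U' leU' subU.
have [->|/set0Pn[u0 u0U']] := eqVneq U' finset.set0.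
  exists id; split=> [u|w]; first by rewrite inE.
  by rewrite (_ : [set _ in _ | _] = finset.set0) ?cards0 //; apply/setP => u; rewrite !inE.
have smallU u : u \in U' -> 0 < deg A u <= k by move/(subsetP subU); rewrite inE.
pose B := [set e in A | [exists u in U', u \in val e]].
pose fu e := odflt u0 [pick u in U' | u \in val e].
pose fw e := other e (fu e).
have BA : B \subset A by apply/subsetP => e; rewrite inE => /andP[].
have fuP e : e \in B -> fu e \in U' /\ fu e \in val e.
  rewrite inE => /andP[_ /exists_inP[u uU ue]]; rewrite /fu.
  by case: pickP => [v /andP[]//|/(_ u)]; rewrite uU ue.
have degB u : u \in U' -> deg B u = deg A u.
  move=> uU; apply: eq_card => e; rewrite !inE.
  case: (boolP (u \in val e)) => ue; rewrite ?andbF // !andbT.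
  case: (e \in A) => //=; apply/exists_inP; by exists u.
have vB e : e \in B -> val e = [set fu e; fw e].
  by move=> /fuP[_ /otherP[]].
have fwU e : e \in B -> fw e \notin U'.
  move=> eB; apply/negP => /smallU/andP[_ le1].
  have [/smallU/andP[_ le2] eu] := fuP e eB.
  have := critical_edge critA (subsetP BA _ eB) eu; rewrite -/(fw e).
  by move: le1 le2 kD; lia.
have [/forall_inP bound|] := boolP [forall (e | e \in B),
   (deg A (fu e) - deg B (fu e)) + (deg A (fw e) - deg B (fw e))
     + maxn k (deg B (fw e)) <= D].
  case: (@no_alternator k A B fu fw critA BA) => //.
  - have /smallU/andP[/card_gt0P[e + _]] := u0U'; rewrite inE => /andP[eA ue].
    by apply/set0Pn; exists e; rewrite inE eA; apply/exists_inP; exists u0.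
  - move=> e f eB fB; apply: contra (fwU f fB) => /eqP <-.
    by have [] := fuP e eB.
  - move=> x; have [->|/set0Pn[e]] := eqVneq (at_u fu B x) finset.set0.
      by rewrite cards0.
    rewrite inE => /andP[eB /eqP ex].
    have [xU _] := fuP e eB; rewrite ex in xU.
    apply: (@leq_trans (deg A x)); last by have /andP[] := smallU _ xU.
    apply/subset_leq_card/subsetP => f; rewrite [f \in at_u _ _ _]inE => /andP[fB /eqP <-].
    by have [_ ff] := fuP _ fB; rewrite inE (subsetP BA).
rewrite negb_forall => /existsP[e]; rewrite negb_imply -ltnNge => /andP[eB].
have [eU eu] := fuP e eB; rewrite (degB _ eU) subnn add0n.
set w := fw e => big.
have le_w : deg B w <= deg A w by apply: degS.
have leDw := leD w.
have small_w : deg B w <= k.-1 by move: big le_w leDw; lia.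
(* The inequality [big] reads D < deg A w - deg B w + maxn k (deg B w); since
   deg A w <= D, the maximum is k. *)
have big_w : D + 2 <= deg A w + k.
  have : 0 < deg B w by apply: (deg_gt0 eB); apply: mem_other.
  by move: big le_w leDw; lia.
pose U1 := [set u in U' | [exists f in A, val f == [set u; w]]].
have U1U' : U1 \subset U' by apply/subsetP => u; rewrite inE => /andP[].
have [||m [m1 m2]] := IHn (U' :\: U1).
- rewrite -ltnS; apply: leq_trans leU'; rewrite ltnS; apply: proper_card.
  apply/properP; split; first exact: subsetDl.
  exists (fu e) => //; rewrite !inE eU andbT negbK.
  by apply/exists_inP; exists e; rewrite ?(subsetP BA) // vB.
- by apply: subset_trans subU; apply: subsetDl.
exists (fun u => if u \in U1 then w else m u); split.
  move=> u uU; case: ifPn => u1; last by apply: m1; rewrite inE u1.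
  split=> //; move: u1; rewrite inE => /andP[_ /exists_inP[f fA /eqP vf]].
  by exists f.
move=> v; have [vw|vw] := eqVneq w v.
  rewrite -vw; apply: leq_trans small_w.
  pose h (f : edge G) := other f w.
  apply: (@leq_trans #|[set h f | f in [set f in B | w \in val f]]|); last first.
    exact: leq_imset_card.
  apply/subset_leq_card/subsetP => u; rewrite inE => /andP[uU].
  case: ifPn => u1.
    move: u1; rewrite inE => /andP[_ /exists_inP[f fA /eqP vf]] _.
    have wf : w \in val f by rewrite vf !inE eqxx orbT.
    apply/imsetP; exists f.
      rewrite inE wf andbT inE fA; apply/exists_inP; exists u => //.
      by rewrite vf !inE eqxx.
    have [wo vf'] := otherP wf; rewrite /h.
    have : u \in [set w; other f w] by rewrite -vf' vf !inE eqxx.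
    have uw : u != w by apply: contraTneq uU => ->; apply: fwU.
    by rewrite !inE (negPf uw) => /eqP.
  have [|_ [f fA vf]] := m1 u; first by rewrite inE u1.
  move=> /eqP mw; case/negP: u1; rewrite inE uU; apply/exists_inP; exists f => //.
  by rewrite vf mw.
apply: leq_trans (m2 v); apply/subset_leq_card/subsetP => u.
rewrite inE => /andP[uU]; case: ifPn => u1 /eqP mv.
  by rewrite mv eqxx in vw.
by rewrite inE mv eqxx andbT inE u1.
Qed.

End CriticalEdgeSets.

(** * Discharging *)

Section Discharging.

Variable G : sgraph.
Implicit Types (A : {set edge G}) (e f : edge G) (u v w x y : G) (X : {set G}).

Lemma edge_of_adj x y : adj x y -> exists e : edge G, val e = [set x; y].
Proof.
move=> xy; have h : [set x; y] \in edge_set G.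
  by rewrite inE; apply/existsP; exists x; apply/existsP; exists y; rewrite xy eqxx.
by exists (exist (fun E => is_true (E \in edge_set G)) _ h).
Qed.

Lemma card_edge e : #|val e| = 2.
Proof. by have [x [y [xy _ ->]]] := edge_ends e; rewrite cards2 xy. Qed.

Lemma handshake A : \sum_v deg A v = 2 * #|A|.
Proof.
transitivity (\sum_v \sum_(e in A) (v \in val e : nat)).
  apply: eq_bigr => v _; rewrite /deg -sum1dep_card big_mkcondr /=.
  by apply: eq_bigr => e _; case: (_ \in _).
rewrite exchange_big /= mulnC -sum_nat_const; apply: eq_bigr => e _.
by rewrite -(card_edge e) -sum1_card [RHS]big_mkcond; apply: eq_bigr => v _; case: (_ \in _).
Qed.

Definition support A := [set v | 0 < deg A v].

Definition triangles_in A := [set X in triangles G | [forall e : edge G, (val e \subset X) ==> (e \in A)]].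

Lemma triangle_edge A X x y : X \in triangles_in A -> x \in X -> y \in X -> x != y ->
  exists2 e, e \in A & val e = [set x; y].
Proof.
rewrite inE => /andP[+ /forallP inA]; rewrite inE => /andP[_ /forall_inP adjX] xX yX xy.
have [e ve] : exists e : edge G, val e = [set x; y].
  by apply: edge_of_adj; have /forall_inP/(_ y yX)/implyP/(_ xy) := adjX x xX.
exists e => //; have /implyP := inA e; apply.
by rewrite ve subUset !sub1set xX.
Qed.

Lemma card_triangle A X : X \in triangles_in A -> #|X| = 3.
Proof. by rewrite !inE => /andP[/andP[/eqP]]. Qed.

Definition triangles_at A v := [set X in triangles_in A | v \in X].

(** Each triangle at v contains two edges at v, and no edge is in two
triangles. *)
Lemma kite_free_triangles A v : kite_free G -> 2 * #|triangles_at A v| <= deg A v.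
Proof.
move=> nokite; pose Ev := [set e in A | v \in val e].
apply: (@leq_trans (\sum_(X in triangles_at A v) #|[set e in Ev | val e \subset X]|)).
  rewrite mulnC -sum_nat_const; apply: leq_sum => X; rewrite inE => /andP[tX vX].
  have : #|X :\ v| = 2 by have := card_triangle tX; rewrite (cardsD1 v) vX => -[].
  move=> /eqP/cards2P[a [b [ab Xv]]].
  have : a \in X :\ v by rewrite Xv !inE eqxx.
  have : b \in X :\ v by rewrite Xv !inE eqxx orbT.
  rewrite !inE => /andP[bv bX] /andP[av aX].
  have va : v != a by rewrite eq_sym.
  have vb : v != b by rewrite eq_sym.
  have [e eA ve] := triangle_edge tX vX aX va.
  have [f fA vf] := triangle_edge tX vX bX vb.
  have ef : e != f.
    apply/eqP => ef; have : b \in val e by rewrite ef vf !inE eqxx orbT.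
    by rewrite ve !inE (negPf bv) eq_sym (negPf ab).
  apply/card_gt1P; exists e, f; split=> //; rewrite !inE ?eA ?fA ?ve ?vf.
    by rewrite !inE eqxx subUset !sub1set vX.
  by rewrite !inE eqxx subUset !sub1set vX.
under eq_bigr do rewrite -sum1dep_card.
rewrite (exchange_big_dep (mem Ev)) /=; last by move=> X e _ /andP[].
rewrite /deg -/Ev -sum1_card; apply: leq_sum => e eEv.
rewrite sum1dep_card; apply/card_le1_eqP => X Y; rewrite !inE.
move=> /andP[/andP[/andP[X3 _] _] /andP[_ eX]] /andP[/andP[/andP[Y3 _] _] /andP[_ eY]].
apply/eqP/negPn/negP => XY.
by case: (nokite Y X _ _ XY); [rewrite inE| rewrite inE|exists e; rewrite eX eY].
Qed.

Lemma sum_fibres (P : pred G) (m : G -> G) :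
  \sum_v #|[set u | P u && (m u == v)]| = #|[set u | P u]|.
Proof.
rewrite -[RHS]sum1dep_card [RHS](partition_big m xpredT) //=.
by apply: eq_bigr => v _; rewrite sum1dep_card.
Qed.

(** All charges are doubled, so that triangles take the integer amount 1.  The
functions n2 and n3 count the vertices of which v is the 2-master and the
3-master, and t counts the triangles that v has to pay for. *)
Lemma discharging (C : choiceType) (L : edge G -> {fset C}) (D : nat) A :
  kite_free G -> 9 <= D -> (forall e, D <= #|` L e|) ->
  (forall v, deg A v <= D) -> critical L A ->
  4 * #|support A| + #|triangles_in A| <= 2 * #|A|.
Proof.
move=> nokite D9 leL leD critA.
have [|m2 [m2P c2]] := @masters G C L D leL 2 A isT critA leD; first by lia.
have [|m3 [m3P c3]] := @masters G C L D leL 3 A isT critA leD; first by lia.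
pose n2 v := #|[set u | (0 < deg A u <= 2) && (m2 u == v)]|.
pose n3 v := #|[set u | (0 < deg A u <= 3) && (m3 u == v)]|.
pose t v := if 6 <= deg A v then #|triangles_at A v| else 0.
have edge_sum e x y : e \in A -> val e = [set x; y] -> x != y ->
    D + 2 <= deg A x + deg A y.
  move=> eA ve xy; have xe : x \in val e by rewrite ve !inE eqxx.
  have ye : y \in val e by rewrite ve !inE eqxx orbT.
  have := critical_edge leL critA eA xe; have [xo vo] := otherP xe.
  suff -> : other e x = y by [].
  by move: ye; rewrite vo !inE [y == x]eq_sym (negPf xy) => /eqP.
(* Two vertices of degree at most 5 are not adjacent, as 5 + 5 < 9 + 2. *)
have t_sum : 2 * #|triangles_in A| <= \sum_v t v.
  apply: (@leq_trans (\sum_(X in triangles_in A) #|[set v in X | 6 <= deg A v]|)).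
    rewrite mulnC -sum_nat_const; apply: leq_sum => X tX.
    have : #|[set v in X | deg A v < 6]| <= 1.
      apply/card_le1_eqP => x y; rewrite !inE => /andP[xX dx] /andP[yX dy].
      apply/eqP/negPn/negP => xy.
      have [e eA ve] := triangle_edge tX yX xX xy.
      have := edge_sum _ _ _ eA ve xy; move: dx dy D9; lia.
    have := card_triangle tX; rewrite -(cardsID [set v | 6 <= deg A v] X).
    have -> : X :&: [set v | 6 <= deg A v] = [set v in X | 6 <= deg A v].
      by apply/setP => v; rewrite !inE.
    have -> : X :\: [set v | 6 <= deg A v] = [set v in X | deg A v < 6].
      by apply/setP => v; rewrite !inE -ltnNge andbC.
    lia.
  under eq_bigr do rewrite -sum1dep_card.
  rewrite (exchange_big_dep (fun v => 6 <= deg A v)) /=; last by move=> X e _ /andP[].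
  rewrite [leqLHS]big_mkcond; apply: leq_sum => v _; rewrite /t.
  case: ifP => // d6; rewrite sum1dep_card; apply/subset_leq_card/subsetP => X.
  by rewrite !inE => /and3P[-> ->].
(* The tight cases are degrees 2, 3, 4, the degree 8 with D = 9 and the vertices
   of degree 9, which may pay for four triangles, one 2-vertex and two
   3-vertices. *)
have local v : 8 * (0 < deg A v) + t v + 2 * n2 v + 2 * n3 v
    <= 2 * deg A v + 2 * (0 < deg A v <= 2) + 2 * (0 < deg A v <= 3).
  have := c2 v; have := c3 v; rewrite -/(n2 v) -/(n3 v) /= => le3 le2.
  have n2D : 0 < n2 v -> D <= deg A v.
    case/card_gt0P => u; rewrite inE => /andP[/m2P + /eqP mu].
    by rewrite mu leq_add2r.
  have n3D : 0 < n3 v -> D <= deg A v + 1.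
    case/card_gt0P => u; rewrite inE => /andP[/m3P + /eqP mu].
    by rewrite mu; lia.
  have d2 : 0 < deg A v -> 2 <= deg A v.
    move=> /card_gt0P[e]; rewrite inE => /andP[eA ve].
    have := critical_edge leL critA eA ve; have := leD (other e v); lia.
  have := kite_free_triangles A v nokite; rewrite /t.
  move: d2 n2D n3D le2 le3 D9; set d := deg A v.
  case: ifP; lia.
have : \sum_v (8 * (0 < deg A v) + t v + 2 * n2 v + 2 * n3 v)
  <= \sum_v (2 * deg A v + 2 * (0 < deg A v <= 2) + 2 * (0 < deg A v <= 3)).
  by apply: leq_sum.
have distr (c : nat) (F : G -> nat) : \sum_v c * F v = c * \sum_v F v.
  by rewrite big_distrr.
have split2 (E F : G -> nat) : \sum_v (E v + F v) = \sum_v E v + \sum_v F v.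
  by rewrite big_split.
rewrite [leqLHS]split2 [in leqLHS]split2 [in leqLHS]split2.
rewrite [leqRHS]split2 [in leqRHS]split2 !distr handshake /n2 /n3.
rewrite (sum_fibres (fun u => 0 < deg A u <= 2)) (sum_fibres (fun u => 0 < deg A u <= 3)).
have cardE (P : pred G) : \sum_v (P v : nat) = #|[set v | P v]|.
  by rewrite -sum1dep_card [RHS]big_mkcond; apply: eq_bigr => v _; case: (P v).
rewrite !cardE -/(support A); move: t_sum; lia.
Qed.

End Discharging.

(** * Counting edges with face boundaries *)

Section MacLane.

Variable G : sgraph.
Implicit Types (A Z : {set edge G}) (e f : edge G) (u v w x y a b : G) (X : {set G}).

Lemma edge_adj e x y : x != y -> x \in val e -> y \in val e -> adj x y.
Proof.
have [a [b [_ ab ->]]] := edge_ends e; rewrite !inE.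
move=> xy /orP[]/eqP xE /orP[]/eqP yE; move: xy; rewrite xE yE.
- by rewrite eqxx.
- by [].
- by rewrite adj_sym.
- by rewrite eqxx.
Qed.

Lemma edge_val e x y : x != y -> x \in val e -> y \in val e -> val e = [set x; y].
Proof.
move=> xy xe; have [_ ->] := otherP xe.
by rewrite !inE [y == x]eq_sym (negPf xy) /= => /eqP->.
Qed.

Lemma edge_eq e f x y : x != y -> x \in val e -> y \in val e ->
  x \in val f -> y \in val f -> e = f.
Proof.
move=> xy xe ye xf yf; apply: val_inj.
by rewrite (edge_val xy xe ye) (edge_val xy xf yf).
Qed.

(** From an edge xy of Z, evenness yields another edge xa and another edge yb of
Z.  If there are only three edges, evenness at a forces a = b. *)
Lemma even_edge_set A Z : Z \subset A -> Z != finset.set0 ->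
  (forall v, ~~ odd (deg Z v)) -> #|Z| < 4 ->
  #|Z| = 3 /\ exists2 X, X \in triangles_in A & Z = [set e : edge G | val e \subset X].
Proof.
move=> ZA /set0Pn[e0 e0Z] evenZ lt4.
have second e x : e \in Z -> x \in val e ->
    exists f, [/\ f \in Z, f != e & x \in val f].
  move=> eZ xe; have : 1 < deg Z x.
    by have := evenZ x; have := deg_gt0 eZ xe; case: (deg Z x) => [|[]].
  case/card_gt1P => f [g [+ + fg]]; rewrite !inE => /andP[fZ xf] /andP[gZ xg].
  have [fe|fe] := eqVneq f e; last by exists f.
  by exists g; split=> //; rewrite -fe eq_sym.
have [x [y [xy _ v0]]] := edge_ends e0.
have x0 : x \in val e0 by rewrite v0 !inE eqxx.
have y0 : y \in val e0 by rewrite v0 !inE eqxx orbT.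
have [e1 [e1Z e10 x1]] := second _ _ e0Z x0.
have [e2 [e2Z e20 y2]] := second _ _ e0Z y0.
have [xa v1] := otherP x1; have a1 := mem_other x1; set a := other e1 x in xa v1 a1.
have y1 : y \notin val e1.
  by apply: contra e10 => y1; apply/eqP; apply: (edge_eq xy).
have ya : y != a by apply: contraNneq y1 => ->.
have x2 : x \notin val e2.
  by apply: contra e20 => x2; apply/eqP; apply: (edge_eq xy).
have e12 : e1 != e2 by apply: contraNneq y1 => ->.
have c3 : #|[set e0; e1; e2]| = 3.
  by rewrite -setUA cardsU1 cards2 !inE e12 negb_or ![e0 == _]eq_sym e10 e20.
have Z3 : [set e0; e1; e2] = Z.
  apply/eqP; rewrite eqEcard c3 -ltnS lt4 andbT.
  by rewrite !subUset !sub1set e0Z e1Z e2Z.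
have a0 : a \notin val e0 by rewrite v0 !inE negb_or ![a == _]eq_sym xa.
have a2 : a \in val e2.
  have [f [fZ f1 af]] := second _ _ e1Z a1.
  move: fZ f1 af; rewrite -Z3 !inE => /orP[/orP[]|] /eqP-> //; last by rewrite eqxx.
  by rewrite (negPf a0).
have xe1 : val e1 = [set x; a] by apply: edge_val.
have ye2 : val e2 = [set y; a] by apply: edge_val.
have Z_eq : Z = [set e : edge G | val e \subset [set x; y; a]].
  apply/setP => e; rewrite -Z3 !inE; apply/idP/idP.
    case/orP=> [/orP[]|] /eqP->; rewrite ?v0 ?xe1 ?ye2 subUset !sub1set !inE !eqxx;
    by rewrite ?orbT.
  have [b [c [bc _ vb]]] := edge_ends e; rewrite vb subUset !sub1set !inE.
  have be : b \in val e by rewrite vb !inE eqxx.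
  have ce : c \in val e by rewrite vb !inE eqxx orbT.
  have same f : b \in val f -> c \in val f -> e == f.
    by move=> bf cf; apply/eqP; apply: (edge_eq bc).
  case/andP; rewrite -!orbA => /or3P[]/eqP bE /or3P[]/eqP cE;
    move: bc; rewrite bE cE ?eqxx // => _.
  - by rewrite (same e0) // ?bE ?cE.
  - by rewrite (same e1) ?orbT // ?bE ?cE.
  - by rewrite (same e0) // ?bE ?cE.
  - by rewrite (same e2) ?orbT // ?bE ?cE.
  - by rewrite (same e1) ?orbT // ?bE ?cE.
  - by rewrite (same e2) ?orbT // ?bE ?cE.
split; first by rewrite -Z3.
exists [set x; y; a] => //; rewrite inE; apply/andP; split; last first.
  apply/forallP => e; apply/implyP => eX; apply: (subsetP ZA).
  by rewrite Z_eq inE.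
rewrite inE; apply/andP; split.
  by rewrite -setUA cardsU1 cards2 !inE ya negb_or xy xa.
apply/forall_inP => b; rewrite !inE => bX; apply/forall_inP => c; rewrite !inE => cX.
apply/implyP => bc; move: bX cX.
have adj_xy : adj x y by apply: (edge_adj xy x0 y0).
have adj_xa : adj x a by apply: (edge_adj xa x1 a1).
have adj_ya : adj y a by apply: (edge_adj ya y2 a2).
rewrite -!orbA => /or3P[]/eqP bE /or3P[]/eqP cE; move: bc; rewrite bE cE ?eqxx // => _;
by rewrite adj_sym.
Qed.

Local Open Scope ring_scope.

Lemma F2_nat_eq0 n : (n%:R == 0 :> 'F_2) = ~~ odd n.
Proof. by rewrite -(dvdn_pcharf (pchar_Fp (isT : prime 2))) dvdn2. Qed.

Lemma F2_neq0 (a : 'F_2) : a = (a != 0)%:R.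
Proof. by apply/val_inj; case: a => [[|[|[]]]]. Qed.

Lemma F2_sum_nat (I : finType) (P : pred I) (z : I -> 'F_2) :
  \sum_(i | P i) z i = #|[set i | P i && (z i != 0)]|%:R.
Proof.
rewrite -sum1dep_card natr_sum [RHS]big_mkcondr /=; apply: eq_bigr => i _.
by rewrite {1}(F2_neq0 (z i)); case: (z i != 0).
Qed.

(** The two hypotheses say that the boundary of each face is even at each vertex
and that these boundaries span the even edge sets.  The kernel of the incidence
matrix Inc has dimension at least |A| - |support A| + 1, because the sum of the
columns of Inc vanishes modulo 2.  A maximal independent family of rows of the
boundary matrix M consists of distinct nonempty even sets, which cover each edge
at most twice. *)
Lemma maclane_bound A (Phi : finType) (l r : edge G -> Phi) :
  A != finset.set0 ->
  (forall phi v, \sum_(e in A | v \in val e)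
      ((l e == phi)%:R + (r e == phi)%:R) = 0 :> 'F_2) ->
  (forall z : edge G -> 'F_2,
     (forall v, \sum_(e in A | v \in val e) z e = 0) ->
     exists S : Phi -> 'F_2, {in A, forall e, z e = S (l e) + S (r e)}) ->
  (2 * #|A| + 4 <= 4 * #|support A| + #|triangles_in A|)%N.
Proof.
move=> A0 even_bd span_bd.
pose b phi e : 'F_2 := (l e == phi)%:R + (r e == phi)%:R.
pose M := \matrix_(i < #|Phi|, j < #|A|) b (enum_val i) (enum_val j).
pose Inc := \matrix_(j < #|A|, k < #|support A|)
   ((enum_val k \in val (enum_val j : edge G))%:R : 'F_2).
have IncE (z : edge G -> 'F_2) v : v \in support A ->
   \sum_(e in A | v \in val e) z e
   = \sum_(j < #|A|) z (enum_val j) * (v \in val (enum_val j : edge G))%:R.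
  move=> vA; rewrite big_mkcondr big_enum_val; apply: eq_bigr => j _.
  by case: (_ \in _); rewrite ?mulr1 ?mulr0.
have [e0 e0A] : exists e, e \in A by apply/set0Pn.
have supp e v : e \in A -> v \in val e -> v \in support A.
  by move=> eA ve; rewrite inE; apply: deg_gt0 ve.
have [x0 xe0] : exists x, x \in val e0.
  by have [x [y [_ _ ->]]] := edge_ends e0; exists x; rewrite !inE eqxx.
pose k0 := enum_rank_in (supp e0 x0 e0A xe0) x0.
have rankInc : (\rank Inc < #|support A|)%N.
  have := @mulmx0_rank_max _ _ _ _ Inc (const_mx 1 : 'cV_#|support A|).
  have -> : \rank (const_mx 1 : 'cV['F_2]_#|support A|) = 1%N.
    rewrite -mxrank_tr trmx_const rank_rV; case: eqP => // /matrixP/(_ 0 k0)/eqP.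
    by rewrite !mxE oner_eq0.
  rewrite addn1; apply; apply/matrixP => j k; rewrite !mxE.
  under eq_bigr do rewrite !mxE mulr1.
  rewrite -(big_enum_val (A := mem (support A)) (fun v => (v \in val (enum_val j))%:R)).
  have jA : enum_val j \in A by apply: enum_valP.
  apply/eqP; rewrite -natr_sum F2_nat_eq0 -big_mkcondr /= sum1dep_card.
  rewrite (_ : #|_| = 2%N) // -(card_edge (enum_val j)); apply: eq_card => v.
  rewrite !inE; case: (boolP (v \in val (enum_val j))) => vj; last by rewrite andbF.
  by have := supp _ _ jA vj; rewrite inE => ->.
(* Extend a kernel vector by 0 outside A and express it by boundaries. *)
have kerM : (kermx Inc <= M)%MS.
  apply/row_subP => i; set z := row i _.
  have zInc : z *m Inc = 0 by rewrite -row_mul mulmx_ker row0.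
  move: z zInc => z zInc.
  pose z' e := if e \in A then z 0 (enum_rank_in e0A e) else 0.
  have zz' j : z' (enum_val j) = z 0 j by rewrite /z' enum_valP enum_valK_in.
  have [v|S zS] := span_bd z'.
    have [vA|vA] := boolP (v \in support A); last first.
      apply: big_pred0 => e; apply/negP => /andP[eA ve].
      by rewrite (supp _ _ eA ve) in vA.
    rewrite IncE //; have /matrixP/(_ 0 (enum_rank_in vA v)) := zInc.
    rewrite !mxE => zk; rewrite -[RHS]zk; apply: eq_bigr => j _.
    by rewrite zz' !mxE enum_rankK_in.
  have -> : z = (\row_i S (enum_val i)) *m M; last exact: submxMl.
  apply/matrixP => a j; rewrite ord1 -zz' zS ?enum_valP // !mxE.
  under eq_bigr do rewrite !mxE.
  rewrite -(big_enum_val (A := mem Phi) (fun phi => S phi * b phi (enum_val j))).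
  have delta (x : Phi) : \sum_(phi in Phi) S phi * (x == phi)%:R = S x.
    rewrite (bigD1 x) //= eqxx mulr1 big1 ?addr0 // => phi /negPf.
    by rewrite eq_sym => ->; rewrite mulr0.
  by under eq_bigr do rewrite mulrDr; rewrite big_split /= !delta.
have rankM : (#|A| + 1 <= \rank M + #|support A|)%N.
  have := mxrankS kerM; rewrite mxrank_ker; move: rankInc; lia.
pose F := maxrankfun M.
pose Zs i := [set e in A | b (enum_val (F i)) e != 0].
have Zeven i v : ~~ odd (deg (Zs i) v).
  rewrite -F2_nat_eq0 -(even_bd (enum_val (F i)) v) F2_sum_nat.
  by apply/eqP; congr (_%:R); apply: eq_card => e; rewrite !inE andbAC.
have Zfree : row_free (rowsub F M) := maxrowsub_free M.
have row_entry i (j : 'I_#|A|) :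
    row i (rowsub F M) 0 j = (enum_val j \in Zs i)%:R.
  by rewrite !mxE inE enum_valP -F2_neq0.
have Minj : injective (fun d : 'rV['F_2]_(\rank M) => d *m rowsub F M).
  exact: row_free_inj.
have Z0 i : Zs i != finset.set0.
  apply/eqP => Zi; suff /matrixP/(_ 0 i)/eqP : delta_mx 0 i = 0 :> 'rV['F_2]_(\rank M).
    by rewrite !mxE !eqxx oner_eq0.
  apply: Minj => /=; rewrite -rowE mul0mx; apply/matrixP => a j.
  by rewrite ord1 row_entry Zi inE mxE.
have Zinj : injective Zs.
  move=> i i' Zi; suff /matrixP/(_ 0 i)/eqP :
      delta_mx 0 i = delta_mx 0 i' :> 'rV['F_2]_(\rank M).
    by rewrite !mxE !eqxx; case: (i =P i').
  apply: Minj => /=; rewrite -!rowE; apply/matrixP => a j.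
  by rewrite ord1 !row_entry Zi.
have sumZ : (\sum_i #|Zs i| <= 2 * #|A|)%N.
  under eq_bigr do rewrite -sum1dep_card.
  rewrite (exchange_big_dep (mem A)) /=; last by move=> i e _ /andP[].
  rewrite mulnC -sum_nat_const; apply: leq_sum => e eA.
  rewrite sum1dep_card; have Finj : injective (fun i => enum_val (F i) : Phi).
    by move=> i i' /enum_val_inj/maxrankfun_inj.
  rewrite -(card_imset _ Finj); apply: (@leq_trans #|[set l e; r e]|); last first.
    by rewrite cards2; case: (_ != _).
  apply/subset_leq_card/subsetP => phi /imsetP[i]; rewrite inE => /andP[_] + ->.
  rewrite /b !inE ![enum_val _ == _]eq_sym.
  by case: (l e == _); case: (r e == _).
have lowZ : (4 * \rank M <= \sum_i #|Zs i| + #|triangles_in A|)%N.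
  pose Q := [set i | (#|Zs i| < 4)%N].
  have leQ : (#|Q| <= #|triangles_in A|)%N.
    rewrite -(card_imset Q Zinj).
    apply: leq_trans (leq_imset_card (fun X => [set e : edge G | val e \subset X]) (mem (triangles_in A))).
    apply/subset_leq_card/subsetP => Z /imsetP[i]; rewrite inE => Qi ->.
    have ZA : Zs i \subset A by apply/subsetP => e; rewrite inE => /andP[].
    have [_ [X XA ->]] := even_edge_set ZA (Z0 i) (Zeven i) Qi.
    by apply/imsetP; exists X.
  apply: leq_trans (leq_add (leqnn _) leQ).
  have -> : #|Q| = (\sum_i (#|Zs i| < 4))%N.
    by rewrite -[LHS]sum1_card big_mkcond; apply: eq_bigr => i _; rewrite inE.
  rewrite mulnC -{1}(card_ord (\rank M)) -sum_nat_const -big_split /=.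
  apply: leq_sum => i _; have ZA : Zs i \subset A.
    by apply/subsetP => e; rewrite inE => /andP[].
  have [Zi|Zi] := ltnP #|Zs i| 4; last by rewrite addn0.
  by have [-> _] := even_edge_set ZA (Z0 i) (Zeven i) Zi.
by move: rankM sumZ lowZ; lia.
Qed.

End MacLane.

(** * Winding numbers in the square grid *)

Section Grid.

Local Open Scope ring_scope.

Definition cell := (int * int)%type.

(** Equality of c and d is allowed, because consecutive samples of an arc may
fall into the same cell. *)
Definition step (c d : cell) : bool := `|c.1 - d.1| + `|c.2 - d.2| <= 1.

(** A face of the grid is a unit square between four cells, and is denoted by
its lower left cell.  The faces on both sides of the grid edge from c to d are
[low c d] and [side c d], which are equal when c = d. *)
Definition low (c d : cell) : cell := (Num.min c.1 d.1, Num.min c.2 d.2).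
Definition side (c d : cell) : cell :=
  ((low c d).1 - `|c.2 - d.2|, (low c d).2 - `|c.1 - d.1|).

(** The grid edges crossed by a vertical ray going down from the face f. *)
Definition below (f c d : cell) : bool :=
  [&& c.2 == d.2, c.2 <= f.2 &
   (c.1 == f.1) && (d.1 == f.1 + 1) || (d.1 == f.1) && (c.1 == f.1 + 1)].

Definition traverses (a a' c d : cell) : bool :=
  (c == a) && (d == a') || (c == a') && (d == a).

(** For a vertical edge between a and a', the cells from its lower end down.  The
rays going down from the two faces beside the edge enclose these cells. *)
Definition ray (a a' c : cell) : bool :=
  [&& a.2 != a'.2, c.1 == (low a a').1 & c.2 <= (low a a').2].

Lemma low_sym c d : low c d = low d c.
Proof. by rewrite /low minC [X in (_, X)]minC. Qed.

Lemma side_sym c d : side c d = side d c.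
Proof. by rewrite /side low_sym (distrC c.1) (distrC c.2). Qed.

Lemma traverses_sym a a' c d : traverses a a' c d = traverses a' a c d.
Proof. by rewrite /traverses orbC. Qed.

Lemma traverses_symr a a' c d : traverses a a' c d = traverses a a' d c.
Proof. by rewrite /traverses orbC [X in X || _]andbC [X in _ || X]andbC. Qed.

Lemma ray_sym a a' c : ray a a' c = ray a' a c.
Proof. by rewrite /ray low_sym eq_sym. Qed.

Lemma below_sym f c d : below f c d = below f d c.
Proof.
by rewrite /below eq_sym orbC; case: eqP => //= ->.
Qed.

Lemma stepP (P : cell -> cell -> Prop) :
  (forall c d, P c d -> P d c) -> (forall c, P c c) ->
  (forall i j, P (i, j) (i + 1, j)) -> (forall i j, P (i, j) (i, j + 1)) ->
  forall c d, step c d -> P c d.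
Proof.
move=> Psym Prefl Pright Pup [c1 c2] [d1 d2]; rewrite /step /= => cd.
have [<-|[<-|[<-|[<-|<-]]]] : (c1, c2) = (d1, d2) \/ (c1 + 1, c2) = (d1, d2)
  \/ (c1, c2 + 1) = (d1, d2) \/ (c1 - 1, c2) = (d1, d2) \/ (c1, c2 - 1) = (d1, d2).
- have : [|| (c1 == d1) && (c2 == d2), (c1 + 1 == d1) && (c2 == d2),
    (c1 == d1) && (c2 + 1 == d2), (c1 - 1 == d1) && (c2 == d2) |
    (c1 == d1) && (c2 - 1 == d2)] by lia.
  case/or4P => [||| /orP[]] /andP[/eqP-> /eqP->];
  by [left|right; left|do 2!right; left|do 3!right; left|do 4!right].
- exact: Prefl.
- exact: Pright.
- exact: Pup.
- by apply: Psym; rewrite -{2}(subrK 1 c1); apply: Pright.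
- by apply: Psym; rewrite -{2}(subrK 1 c2); apply: Pup.
Qed.

Lemma low_right i j : low (i, j) (i + 1, j) = (i, j).
Proof. by rewrite /low /=; congr pair; lia. Qed.

Lemma low_up i j : low (i, j) (i, j + 1) = (i, j).
Proof. by rewrite /low /=; congr pair; lia. Qed.

Lemma side_right i j : side (i, j) (i + 1, j) = (i, j - 1).
Proof. by rewrite /side low_right /=; congr pair; lia. Qed.

Lemma side_up i j : side (i, j) (i, j + 1) = (i - 1, j).
Proof. by rewrite /side low_up /=; congr pair; lia. Qed.

Lemma below_right f k l : below f (k, l) (k + 1, l) = (l <= f.2) && (k == f.1).
Proof. by rewrite /below /= eqxx; case: (l <= _) => //=; lia. Qed.

Lemma below_up f k l : below f (k, l) (k, l + 1) = false.
Proof. by rewrite /below /=; case: eqP => //; lia. Qed.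

Lemma below_refl f c : below f c c = false.
Proof. by rewrite /below; case: eqP => //=; case: (_ <= _) => //=; lia. Qed.

Lemma traverses_refl a a' c : a != a' -> traverses a a' c c = false.
Proof.
by move=> neq; apply: contraNF neq; rewrite /traverses => /orP[]/andP[/eqP<- /eqP<-].
Qed.

(** Across a horizontal edge a a', the rays going down from both faces differ by
that edge only.  Across a vertical one, the two rays together cross the steps
that enter or leave the cells below the edge, except through the edge itself. *)
Lemma flux_step a a' : step a a' -> a != a' -> forall c d, step c d ->
  below (low a a') c d (+) below (side a a') c d
  = traverses a a' c d (+) (ray a a' c (+) ray a a' d).
Proof.
move: a a'; apply: stepP => [a a' IH|a|i j|i j]; rewrite ?eqxx // => neq.
- move=> c d; rewrite low_sym side_sym traverses_sym ray_sym [ray _ _ d]ray_sym.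
  by apply: IH; rewrite eq_sym.
- rewrite low_right side_right /ray /= eqxx /=.
  apply: stepP => [c d IH|c|k l|k l].
  + by rewrite below_sym [below (_, _ - _) _ _]below_sym traverses_symr.
  + by rewrite !below_refl traverses_refl.
  + rewrite !below_right /traverses !xpair_eqE /=; lia.
  + rewrite !below_up /traverses !xpair_eqE /=; lia.
- have jj : j != j + 1 by lia.
  rewrite low_up side_up /ray low_up /= jj /=.
  apply: stepP => [c d IH|c|k l|k l].
  + by rewrite below_sym [below (_ - _, _) _ _]below_sym traverses_symr
      [X in _ = _ (+) X]addbC.
  + by rewrite !below_refl traverses_refl // !addbb.
  + have -> : traverses (i, j) (i, j + 1) (k, l) (k + 1, l) = false.
      by rewrite /traverses !xpair_eqE; lia.
    rewrite !below_right /=.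
    have -> : (k + 1 == i) = (k == i - 1) by lia.
    by case: (l <= j); rewrite ?andbF ?andbT.
  + rewrite !below_up /traverses !xpair_eqE /=.
    case: (k =P i) => /= [_|]; last by rewrite ?andbF.
    have -> : (l + 1 <= j) = (l <= j) && (l != j) by lia.
    have -> : (l == j + 1) && (l + 1 == j) = false by lia.
    have -> : (l + 1 == j + 1) = (l == j) by lia.
    have -> : (l <= j) = (l == j) || (l < j) by lia.
    by case: (l =P j) => [->|]; rewrite ?ltxx //=; case: (l < j).
Qed.

Lemma F2_addb (a b : bool) : (a (+) b)%:R = a%:R + b%:R :> 'F_2.
Proof. by case: a; case: b; apply/val_inj. Qed.

Lemma F2_addxx (a : 'F_2) : a + a = 0.
Proof. by apply: (addrr_pchar2 (pchar_Fp (isT : prime 2))). Qed.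

Fixpoint walk_sum (F : cell -> cell -> bool) (c : cell) (s : seq cell) : 'F_2 :=
  if s is d :: s' then (F c d)%:R + walk_sum F d s' else 0.

(** The ray terms telescope, leaving those of the ends of the walk; they cancel
in the sum over a cycle of the graph. *)
Lemma flux_walk a a' c s : step a a' -> a != a' -> path step c s ->
  walk_sum (below (low a a')) c s + walk_sum (below (side a a')) c s
  = walk_sum (traverses a a') c s + (ray a a' c)%:R + (ray a a' (last c s))%:R.
Proof.
move=> sa na; elim: s c => [|d s IHs] c /=; first by rewrite !addr0 add0r F2_addxx.
case/andP => cd /IHs IH.
have /(congr1 (fun b : bool => b%:R : 'F_2)) := flux_step sa na cd; rewrite !F2_addb => flux.
rewrite addrACA IH flux.
set T := (traverses _ _ _ _)%:R; set W := walk_sum _ _ _.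
set p := (ray a a' c)%:R; set q := (ray a a' d)%:R; set q' := (ray a a' (last d s))%:R.
have -> : T + (p + q) + (W + q + q') = T + W + p + q' + (q + q) by ring.
by rewrite F2_addxx addr0.
Qed.

Lemma walk_sum0 (F : cell -> cell -> bool) (X : seq cell) c s :
  {subset c :: s <= X} -> {in X &, forall a b, F a b = false} -> walk_sum F c s = 0.
Proof.
move=> + F0; elim: s c => [|d s IHs] c //= sX.
rewrite F0 ?sX ?inE ?eqxx ?orbT // IHs ?addr0 // => a as'.
by apply: sX; rewrite inE as' orbT.
Qed.

(** A presentation of G as a minor of the grid: each vertex is contracted from a
region, and each edge e is represented by one grid edge, its bridge, between the
last cells of two walks inside the regions of its ends.  The walks start from
fixed base cells, so that the representatives of the edges of a cycle of G
combine into a closed chain of the grid. *)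
Record grid_model (G : sgraph) := GridModel {
  region : G -> seq cell;
  base : G -> cell;
  tail : edge G -> G;
  head : edge G -> G;
  tail_walk : edge G -> seq cell;
  head_walk : edge G -> seq cell;
  region_uniq v : uniq (region v);
  region_disjoint v w c : c \in region v -> c \in region w -> v = w;
  val_ends e : val e = [set tail e; head e];
  tail_path e : path step (base (tail e)) (tail_walk e);
  head_path e : path step (base (head e)) (head_walk e);
  tail_sub e : {subset base (tail e) :: tail_walk e <= region (tail e)};
  head_sub e : {subset base (head e) :: head_walk e <= region (head e)};
  bridge_step e : step (last (base (tail e)) (tail_walk e))
                    (last (base (head e)) (head_walk e)) }.

Section GridModelTheory.

Variables (G : sgraph) (m : grid_model G).
Implicit Types (A : {set edge G}) (e : edge G) (v w : G) (f c d : cell).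

Let X := region m.
Let b := base m.
Let r1 e := last (b (tail m e)) (tail_walk m e).
Let r2 e := last (b (head m e)) (head_walk m e).

Let tail_head e : tail m e != head m e.
Proof.
apply/eqP => th; have := card_edge e; rewrite (val_ends m e) th setUid cards1.
by [].
Qed.

Let r1X e : r1 e \in X (tail m e).
Proof. by apply: tail_sub; apply: mem_last. Qed.

Let r2X e : r2 e \in X (head m e).
Proof. by apply: head_sub; apply: mem_last. Qed.

Let r12 e : r1 e != r2 e.
Proof.
apply: contraNneq (tail_head e) => r; apply/eqP.
by apply: (region_disjoint (r1X e)); rewrite r; apply: r2X.
Qed.

Let ends_inj e e' : r1 e \in [:: r1 e'; r2 e'] -> r2 e \in [:: r1 e'; r2 e'] -> e = e'.
Proof.
rewrite !inE => h1 h2; apply: val_inj; rewrite !(val_ends m).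
have eqX c d v w : c = d -> c \in X v -> d \in X w -> v = w.
  by move=> -> ; apply: region_disjoint.
have n12 := r12 e.
case/orP: h1 => /eqP h1; case/orP: h2 => /eqP h2.
- by rewrite h1 h2 eqxx in n12.
- by rewrite (eqX _ _ _ _ h1 (r1X _) (r1X _)) (eqX _ _ _ _ h2 (r2X _) (r2X _)).
- by rewrite (eqX _ _ _ _ h1 (r1X _) (r2X _)) (eqX _ _ _ _ h2 (r2X _) (r1X _)) setUC.
- by rewrite h1 h2 eqxx in n12.
Qed.

Definition inner c d := [exists v, (c \in X v) && (d \in X v)].

(** A count along the walk from base to base that represents e.  Its part inside
the region of the head is counted backwards, so F is meant to be symmetric. *)
Definition edge_sum (F : cell -> cell -> bool) e : 'F_2 :=
  walk_sum F (b (tail m e)) (tail_walk m e) + (F (r1 e) (r2 e))%:R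
  + walk_sum F (b (head m e)) (head_walk m e).

Let edge_flux a a' e : step a a' -> a != a' ->
  edge_sum (below (low a a')) e + edge_sum (below (side a a')) e
  = edge_sum (traverses a a') e
    + ((ray a a' (b (tail m e)))%:R + (ray a a' (b (head m e)))%:R).
Proof.
move=> sa na.
have f1 := flux_walk sa na (tail_path m e); have f2 := flux_walk sa na (head_path m e).
have /(congr1 (fun b : bool => b%:R : 'F_2)) := flux_step sa na (bridge_step m e).
rewrite !F2_addb -/(r1 e) -/(r2 e) => f3; rewrite /edge_sum.
have -> (x y z x' y' z' : 'F_2) : x + y + z + (x' + y' + z') = (x + x') + (y + y') + (z + z') by ring.
rewrite f1 f2 f3 -/(r1 e) -/(r2 e).
set T1 := walk_sum _ _ _; set T2 := (traverses _ _ _ _)%:R; set T3 := walk_sum _ _ _.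
set p := (ray a a' (b _))%:R; set q := (ray a a' (b _))%:R.
set p' := (ray a a' (r1 e))%:R; set q' := (ray a a' (r2 e))%:R.
have -> : T1 + p + p' + (T2 + (p' + q')) + (T3 + q + q')
  = T1 + T2 + T3 + (p + q) + (p' + p') + (q' + q') by ring.
by rewrite !F2_addxx ?addr0.
Qed.

Let traverses_inner a a' e : ~~ inner a a' ->
  edge_sum (traverses a a') e = (traverses a a' (r1 e) (r2 e))%:R.
Proof.
move=> ninner; rewrite /edge_sum.
have T0 v : {in X v &, forall c d, traverses a a' c d = false}.
  move=> c d cv dv; apply: contraNF ninner => /orP[]/andP[/eqP<- /eqP<-];
  by apply/existsP; exists v; rewrite ?cv ?dv.
rewrite (walk_sum0 (@tail_sub _ m e) (T0 _)) (walk_sum0 (@head_sub _ m e) (T0 _)).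
by rewrite add0r addr0.
Qed.

Section Faces.
Variable A : {set edge G}.

Definition cycle_sum (z : edge G -> 'F_2) v := \sum_(e in A | v \in val e) z e.

Definition winding (z : edge G -> 'F_2) f := \sum_(e in A) z e * edge_sum (below f) e.

Let winding_flux z a a' : (forall v, cycle_sum z v = 0) -> step a a' -> a != a' ->
  ~~ inner a a' ->
  winding z (low a a') + winding z (side a a')
  = \sum_(e in A) z e * (traverses a a' (r1 e) (r2 e))%:R.
Proof.
move=> z0 sa na ninner; rewrite -big_split /=.
under eq_bigr do rewrite -mulrDr edge_flux // traverses_inner // mulrDr.
rewrite big_split /= -[RHS]addr0; congr (_ + _).
transitivity (\sum_v (ray a a' (b v))%:R * cycle_sum z v); last first.
  by apply: big1 => v _; rewrite z0 mulr0.
under [RHS]eq_bigr do rewrite big_distrr big_mkcondr.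
rewrite exchange_big; apply: eq_bigr => e _ /=.
rewrite (bigD1 (tail m e)) //= (bigD1 (head m e)) 1?eq_sym ?tail_head //=.
rewrite !(val_ends m) !inE !eqxx orbT [X in _ + (_ + X)]big1 ?addr0 => [|v]; last first.
  by move=> /andP[/negPf vt /negPf vh]; rewrite !inE vt vh.
by rewrite mulrDr; congr (_ + _); rewrite mulrC.
Qed.

Definition is_cycle (z : {ffun edge G -> 'F_2}) := [forall v, cycle_sum z v == 0].

(** Faces of A are encoded by the winding numbers that they assign to all cycles,
which makes them a finite type.  Classes thus agree across every grid edge that
lies neither in a region nor on the bridge of an edge of A. *)
Definition face_class f : {ffun {ffun edge G -> 'F_2} -> 'F_2} :=
  [ffun z : {ffun edge G -> 'F_2} => if is_cycle z then winding z f else 0].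

Let left_face e := face_class (low (r1 e) (r2 e)).
Let right_face e := face_class (side (r1 e) (r2 e)).

Let bridge_not_inner e : ~~ inner (r1 e) (r2 e).
Proof.
apply/existsP => -[v /andP[v1 v2]]; have := tail_head e.
by rewrite -(region_disjoint v1 (r1X e)) -(region_disjoint v2 (r2X e)) eqxx.
Qed.

(** A cycle z is the boundary of the faces around which it winds: among the
chains of edges of A, only that of e uses the bridge of e. *)
Lemma cycles_bound (z : edge G -> 'F_2) : (forall v, cycle_sum z v = 0) ->
  exists S : {ffun {ffun edge G -> 'F_2} -> 'F_2} -> 'F_2,
    {in A, forall e, z e = S (left_face e) + S (right_face e)}.
Proof.
move=> z0; exists (fun phi => phi (finfun z)) => e eA.
have zf v : cycle_sum (finfun z) v = 0.
  by rewrite -(z0 v); apply: eq_bigr => e' _; rewrite ffunE.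
have cz : is_cycle (finfun z) by apply/forallP => v; rewrite zf.
rewrite !ffunE cz winding_flux ?bridge_step ?r12 ?bridge_not_inner //.
rewrite (bigD1 e) //= ffunE {1}/traverses !eqxx mulr1 big1 ?addr0 // => e' /andP[_ ne].
suff -> : traverses (r1 e) (r2 e) (r1 e') (r2 e') = false by rewrite mulr0.
apply: contraNF ne => /orP[]/andP[/eqP h1 /eqP h2]; apply/eqP; apply: ends_inj;
by rewrite ?h1 ?h2 !inE eqxx ?orbT.
Qed.

Definition nbrs c : seq cell :=
  [:: (c.1 + 1, c.2); (c.1 - 1, c.2); (c.1, c.2 + 1); (c.1, c.2 - 1)].

Let mem_nbrs c d : (d \in nbrs c) = step c d && (c != d).
Proof.
case: c d => [c1 c2] [d1 d2]; rewrite !inE /step /= !xpair_eqE; lia.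
Qed.

Let uniq_nbrs c : uniq (nbrs c).
Proof. case: c => c1 c2; rewrite /= !inE !xpair_eqE; lia. Qed.

Section OneFace.
Variable phi : {ffun {ffun edge G -> 'F_2} -> 'F_2}.

Let chi f : 'F_2 := (face_class f == phi)%:R.
Let bd c d : 'F_2 := chi (low c d) + chi (side c d).

Let bd_sym c d : bd c d = bd d c.
Proof. by rewrite /bd low_sym side_sym. Qed.

(** Each of the four faces around a cell is beside two of its four edges. *)
Let bd_around c : \sum_(d <- nbrs c) bd c d = 0.
Proof.
case: c => i j; rewrite /nbrs !big_cons big_nil /= /bd.
rewrite low_right side_right low_up side_up.
have -> : low (i, j) (i - 1, j) = (i - 1, j) by rewrite /low /=; congr pair; lia.
have -> : side (i, j) (i - 1, j) = (i - 1, j - 1).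
  by rewrite /side /low /=; congr pair; lia.
have -> : low (i, j) (i, j - 1) = (i, j - 1) by rewrite /low /=; congr pair; lia.
have -> : side (i, j) (i, j - 1) = (i - 1, j - 1).
  by rewrite /side /low /=; congr pair; lia.
set p := chi (i, j); set q := chi (i, j - 1).
set p' := chi (i - 1, j); set q' := chi (i - 1, j - 1).
have -> : p + q + (p' + q' + (p + p' + (q + q' + 0)))
  = (p + p) + (q + q) + (p' + p') + (q' + q') by ring.
by rewrite !F2_addxx ?addr0.
Qed.

Let bd0 c d : step c d -> c != d -> ~~ inner c d ->
  {in A, forall e, traverses c d (r1 e) (r2 e) = false} -> bd c d = 0.
Proof.
move=> sc nc ninner norep; rewrite /bd /chi.
suff -> : face_class (low c d) = face_class (side c d) by rewrite F2_addxx.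
apply/ffunP => z; rewrite !ffunE; case: ifP => // /forallP cz.
apply/eqP; rewrite -subr_eq0.
have -> : - winding z (side c d) = winding z (side c d).
  by apply/eqP; rewrite -subr_eq0 -opprD F2_addxx oppr0.
rewrite winding_flux // => [|v]; last exact/eqP.
by rewrite big1 // => e eA; rewrite norep // mulr0.
Qed.

Let sum_delta (T : eqType) (s : seq T) (P : pred T) (x : T) :
  uniq s -> x \in s -> P x -> \sum_(y <- s | P y) (x == y)%:R = 1 :> 'F_2.
Proof.
move=> us xs Px; rewrite big_mkcond (bigD1_seq x) //= Px eqxx big1 ?addr0 // => y.
by rewrite eq_sym => /negPf->; case: (P y).
Qed.

Lemma sum_symmetric_eq0 (T : Type) (s : seq T) (F : T -> T -> 'F_2) :
  (forall x, F x x = 0) -> (forall x y, F x y = F y x) ->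
  \sum_(x <- s) \sum_(y <- s) F x y = 0.
Proof.
move=> F0 Fsym; elim: s => [|x s IHs]; first by rewrite big_nil.
rewrite !big_cons F0 add0r.
under [X in _ + X]eq_bigr do rewrite big_cons.
rewrite big_split /= IHs addr0.
by under [X in _ + X]eq_bigr do rewrite Fsym; rewrite F2_addxx.
Qed.

(** Add up [bd_around] over the region of v.  Grid edges inside the region are
counted twice; among those that leave it, only the bridges of the edges at v
contribute. *)
Lemma faces_even v :
  \sum_(e in A | v \in val e) ((left_face e == phi)%:R + (right_face e == phi)%:R)
    = 0 :> 'F_2.
Proof.
(* The bridge of e, oriented away from v. *)
pose o e := if tail m e == v then (r1 e, r2 e) else (r2 e, r1 e).
have oP e : v \in val e -> [/\ (o e).1 \in X v, (o e).2 \notin X v,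
    (o e).2 \in nbrs (o e).1 & bd (o e).1 (o e).2 = bd (r1 e) (r2 e)].
  rewrite (val_ends m) in_set2 /o mem_nbrs; have th := tail_head e.
  have stp := bridge_step m e; rewrite -/(r1 e) -/(r2 e) in stp.
  have notin x c : c \in X x -> x != v -> c \notin X v.
    by move=> cx; apply: contraNN => cv; rewrite (region_disjoint cx cv).
  case: (tail m e =P v) => [tv _|/eqP tv /= vh].
    rewrite -tv /= stp r12 r1X; split=> //; rewrite tv.
    by apply: (notin _ _ (r2X e)); rewrite -tv eq_sym.
  have hv : head m e = v by move: vh; rewrite eq_sym (negPf tv) /= => /eqP.
  rewrite /= -{1}hv r2X bd_sym; split=> //; first exact: (notin _ _ (r1X e)).
  by rewrite eq_sym r12 andbT; move: stp; rewrite /step distrC [X in _ + X]distrC.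
have around : \sum_(c <- X v) \sum_(d <- nbrs c) bd c d = 0.
  by rewrite big1 // => c _; apply: bd_around.
have inside : \sum_(c <- X v) \sum_(d <- nbrs c | d \in X v) bd c d = 0.
  have -> : \sum_(c <- X v) \sum_(d <- nbrs c | d \in X v) bd c d
    = \sum_(c <- X v) \sum_(d <- X v) (d \in nbrs c)%:R * bd c d.
    apply: eq_bigr => c _; rewrite -big_filter.
    rewrite (perm_big [seq d <- X v | d \in nbrs c]) ?big_filter ?big_mkcond.
      by apply: eq_bigr => d _; case: (_ \in _); rewrite ?mul1r ?mul0r.
    apply: uniq_perm; rewrite ?filter_uniq ?region_uniq // => d.
    by rewrite !mem_filter andbC.
  apply: sum_symmetric_eq0 => [c|c d]; first by rewrite mem_nbrs eqxx andbF mul0r.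
  rewrite bd_sym !mem_nbrs [c == d]eq_sym; congr (_%:R * _).
  by rewrite /step distrC [X in _ + X]distrC.
transitivity (\sum_(c <- X v) \sum_(d <- nbrs c | d \notin X v) bd c d); last first.
  rewrite -[RHS]around -[LHS]add0r -{1}inside -big_split /=; apply: eq_bigr => c _.
  by rewrite [RHS](bigID (mem (X v))).
have out c d : c \in X v -> d \in nbrs c -> d \notin X v ->
    bd c d = \sum_(e in A | v \in val e) (o e == (c, d))%:R * bd (o e).1 (o e).2.
  move=> cv; rewrite mem_nbrs => /andP[sc nc] dv.
  have [/existsP[e /and3P[eA ve /eqP oe]]|none] :=
      boolP [exists e, [&& e \in A, v \in val e & o e == (c, d)]].
    rewrite (bigD1 e) ?eA //= oe eqxx mul1r big1 ?addr0 // => e' /andP[/andP[eA' ve'] ne].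
    case: eqP => [oe'|]; last by rewrite mul0r.
    case/eqP: ne; apply: ends_inj; move: oe oe'; rewrite /o;
    by case: ifP => _ [<- <-]; case: ifP => _ [h1 h2]; rewrite ?h1 ?h2 !inE eqxx ?orbT.
  rewrite big1 => [|e /andP[eA ve]]; last first.
    case: eqP => [oe|]; last by rewrite mul0r.
    by case/existsP: none; exists e; rewrite eA ve oe eqxx.
  apply: bd0 => // [|e eA].
    apply/existsP => -[w /andP[cw dw]]; case/negP: dv.
    by rewrite -(region_disjoint cw cv).
  apply: contraNF none => tr; apply/existsP; exists e; rewrite eA /=.
  rewrite (val_ends m) in_set2 /o.
  case/orP: tr => /andP[/eqP h1 /eqP h2].
    have tv : tail m e = v by apply: (region_disjoint (r1X e)); rewrite h1.
    by rewrite tv eqxx h1 h2 eqxx.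
  have hv : head m e = v by apply: (region_disjoint (r2X e)); rewrite h2.
  have := tail_head e; rewrite hv eqxx orbT => /negPf ->.
  by rewrite h1 h2 eqxx.
transitivity (\sum_(c <- X v) \sum_(d <- nbrs c | d \notin X v)
   \sum_(e in A | v \in val e) (o e == (c, d))%:R * bd (o e).1 (o e).2); last first.
  rewrite !big_seq; apply: eq_bigr => c cv; rewrite big_seq_cond [RHS]big_seq_cond.
  by apply: eq_bigr => d /andP[dc dv]; rewrite -out.
under [RHS]eq_bigr do rewrite exchange_big; rewrite [RHS]exchange_big /=.
apply: eq_bigr => e /andP[eA ve]; have [in1 out2 nbr12 bd12] := oP _ ve.
rewrite -/(bd (r1 e) (r2 e)) -bd12 -[LHS]mul1r.
rewrite -[X in X * _ = _](sum_delta (region_uniq m v) in1 (P := xpredT)) // big_distrl /=.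
apply: eq_bigr => c _; have [<-|nc] := eqVneq (o e).1 c; last first.
  rewrite mul0r big1 // => d _; case: eqP => [oe|]; last by rewrite mul0r.
  by rewrite oe eqxx in nc.
rewrite mul1r -[LHS]mul1r -[X in X * _ = _](sum_delta (uniq_nbrs _) nbr12 (P := fun d => d \notin X v)) //.
rewrite big_distrl /=; apply: eq_bigr => d _.
by case: (o e) => x y /=; rewrite xpair_eqE eqxx.
Qed.

End OneFace.

Lemma grid_model_bound : A != finset.set0 ->
  (2 * #|A| + 4 <= 4 * #|support A| + #|triangles_in A|)%N.
Proof.
move=> A0; apply: (maclane_bound (l := left_face) (r := right_face)) => //.
  by move=> phi v; apply: faces_even.
exact: cycles_bound.
Qed.

End Faces.
End GridModelTheory.

End Grid.

(** * From sampled arcs to a grid model *)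

Lemma step_sym c d : step c d = step d c.
Proof. by rewrite /step distrC [X in (_ + X)%R]distrC. Qed.

Lemma walk_of_fun (w : nat -> cell) n : (forall i, i < n -> step (w i) (w i.+1)) ->
  exists s, [/\ path step (w 0) s, last (w 0) s = w n
    & forall d, d \in w 0 :: s -> exists2 i, i <= n & d = w i].
Proof.
elim: n => [|n IHn] stepw.
  exists [::]; split=> // d; rewrite inE => /eqP->; by exists 0.
have [|s [ps ls ms]] := IHn; first by move=> i lti; apply: stepw; apply: ltnW.
exists (rcons s (w n.+1)); split.
- by rewrite rcons_path ps ls stepw.
- by rewrite last_rcons.
- move=> d; rewrite -rcons_cons mem_rcons inE => /orP[/eqP->|/ms[i le_i ->]].
    by exists n.+1.
  by exists i => //; apply: leqW.
Qed.

(** The arc of e is sampled by the cells c e 0, ..., c e (3 * N).  Its first and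
last thirds belong to the stars of its ends.  The hypotheses say that samples
share a cell only where the thirds of the arcs meet. *)
Section SampledDrawing.

Variables (G : sgraph) (src tgt : edge G -> G) (b : G -> cell) (N : nat)
  (c : edge G -> nat -> cell).
Implicit Types (e f : edge G) (u v w : G) (k l : nat) (d : cell).

Definition near_end e v k :=
  (k <= N) && (v == src e) || (2 * N <= k <= 3 * N) && (v == tgt e).

Hypothesis ends : forall e, val e = [set src e; tgt e].
Hypothesis c_src : forall e, c e 0 = b (src e).
Hypothesis c_tgt : forall e, c e (3 * N) = b (tgt e).
Hypothesis c_step : forall e k, k < 3 * N -> step (c e k) (c e k.+1).
Hypothesis sep_ends : forall e f v w k l,
  near_end e v k -> near_end f w l -> v <> w -> c e k <> c f l.
Hypothesis sep_mid : forall e f k l,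
  N <= k <= 2 * N -> N <= l <= 2 * N -> e <> f -> c e k <> c f l.
Hypothesis sep_mid_end : forall e f w k l,
  N <= k <= 2 * N -> near_end f w l -> w \notin val e -> c e k <> c f l.

Let src_tgt e : src e != tgt e.
Proof.
apply/eqP => st; have := card_edge e; rewrite ends st setUid cards1.
by [].
Qed.

Definition star v d := exists e k, near_end e v k /\ c e k = d.

Let star_inj v w d : star v d -> star w d -> v = w.
Proof.
move=> [e [k [nk ed]]] [f [l [nl fd]]]; apply/eqP/negPn/negP => /eqP vw.
by apply: (sep_ends nk nl vw); rewrite ed fd.
Qed.

Let star_tgt e k : 2 * N <= k <= 3 * N -> star (tgt e) (c e k).
Proof. by move=> hk; exists e, k; rewrite /near_end hk eqxx orbT. Qed.

Let star_src e k : k <= N -> star (src e) (c e k).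
Proof. by move=> hk; exists e, k; rewrite /near_end hk eqxx. Qed.

(** The bridge of e follows the last sample in the star of src e. *)
Let last_exit e : exists k0, [/\ N <= k0 < 2 * N, star (src e) (c e k0)
  & forall k, k0 < k <= 3 * N -> ~ star (src e) (c e k)].
Proof.
pose P k := (k <= 2 * N) && `[< star (src e) (c e k) >].
have exP : exists k, P k.
  by exists N; rewrite /P; apply/andP; split; [lia | apply/asboolP/star_src].
have ubP k : P k -> k <= 2 * N by case/andP.
have late k : 2 * N <= k <= 3 * N -> ~ star (src e) (c e k).
  move=> hk sk; have := src_tgt e.
  by rewrite (star_inj sk (star_tgt _ hk)) eqxx.
have [k0 /andP[k02 /asboolP sk0] maxk0] := ex_maxnP exP ubP.
exists k0; split=> //.
  apply/andP; split; first by apply: maxk0; apply/andP; split; [lia|apply/asboolP/star_src].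
  rewrite ltn_neqAle k02 andbT; apply/eqP => k0E.
  by apply: (late k0) => //; lia.
move=> k /andP[lt_k le_k] sk; have [le2|gt2] := leqP k (2 * N).
  have : k <= k0 by apply: maxk0; rewrite /P le2; apply/asboolP.
  by rewrite leqNgt lt_k.
by apply: (late k) => //; rewrite (ltnW gt2).
Qed.

Let star_walk v d : star v d -> exists s, [/\ path step (b v) s, last (b v) s = d
  & forall d', d' \in b v :: s -> star v d'].
Proof.
case=> e [k [/orP[]/andP[hk /eqP->] <-]].
  have [|s [ps ls ms]] := @walk_of_fun (c e) k.
    by move=> i lti; apply: c_step; lia.
  rewrite -c_src; exists s; split=> // d' /ms[i le_i ->].
  by apply: star_src; lia.
have [|s] := @walk_of_fun (fun i => c e (3 * N - i)) (3 * N - k).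
  move=> i lti; rewrite step_sym.
  have -> : 3 * N - i = (3 * N - i.+1).+1 by lia.
  by apply: c_step; lia.
rewrite subn0 c_tgt => -[ps ls ms]; exists s; split=> //.
  by rewrite ls; congr c; lia.
move=> d' /ms[i le_i ->]; apply: star_tgt; lia.
Qed.

(** The region of v is its star together with the samples that come after the
last exit on the edges e with tgt e = v.  Such a sample avoids the star of src e
by the choice of the exit, and the other regions by the separation
hypotheses. *)
Lemma grid_model_of_samples : inhabited (grid_model G).
Proof.
have [k0 k0P] := fin_all_exists last_exit.
have k0_bd e : N <= k0 e < 2 * N by have [] := k0P e.
have late_star e k u : k0 e < k <= 3 * N -> star u (c e k) -> u = tgt e.
  move=> hk su; have [_ _ nsrc] := k0P e.
  have [le2|gt2] := leqP (2 * N) k.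
    by apply: (star_inj su); apply: star_tgt; lia.
  have [ue|ue] := boolP (u \in val e).
    move: ue; rewrite ends !inE => /orP[/eqP us|/eqP//].
    by case: (nsrc k hk); rewrite -us.
  case: su => f [l [nl fl]]; case: (@sep_mid_end e f u k l) => //.
  by have := k0_bd e; lia.
have late_late e f k l : k0 e < k <= 3 * N -> k0 f < l <= 3 * N ->
    c e k = c f l -> tgt e = tgt f.
  move=> hk hl ef; have [le2|gt2] := leqP (2 * N) k.
    by apply: (late_star f l) => //; rewrite -ef; apply: star_tgt; lia.
  have [le2'|gt2'] := leqP (2 * N) l.
    by apply/esym/(late_star e k) => //; rewrite ef; apply: star_tgt; lia.
  apply: contrapT => tne; apply: (@sep_mid e f k l) => //.
  - by have := k0_bd e; lia.
  - by have := k0_bd f; lia.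
  - by move=> eef; apply: tne; rewrite eef.
pose inR v d := star v d \/
  exists e k, [/\ tgt e = v, k0 e < k <= 3 * N & c e k = d].
have inR_inj v w d : inR v d -> inR w d -> v = w.
  move=> [sv|[e [k [<- hk ek]]]] [sw|[f [l [<- hl fl]]]].
  - exact: star_inj sv sw.
  - by apply: (late_star f l) => //; rewrite fl.
  - by apply/esym/(late_star e k) => //; rewrite ek.
  - by apply: (late_late e f k l) => //; rewrite ek fl.
pose Omega := [seq c e k | e <- enum (edge G), k <- iota 0 (3 * N).+1].
have inOmega v d : inR v d -> d \in Omega.
  have inO e k : k <= 3 * N -> c e k \in Omega.
    by move=> hk; apply/allpairsP; exists (e, k); rewrite mem_enum mem_iota.
  case=> [[e [k [nk <-]]]|[e [k [_ hk <-]]]]; apply: inO; last by lia.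
  by move: nk; rewrite /near_end => /orP[]/andP[]; lia.
pose region v := [seq d <- undup Omega | `[< inR v d >]].
have regionP v d : reflect (inR v d) (d \in region v).
  rewrite mem_filter mem_undup; apply: (iffP andP) => [[/asboolP]//|h].
  by split; [apply/asboolP | apply: inOmega h].
have tail_walks e : exists s, [/\ path step (b (src e)) s,
    last (b (src e)) s = c e (k0 e) & forall d, d \in b (src e) :: s -> star (src e) d].
  by apply: star_walk; have [] := k0P e.
have head_walks e : exists s, [/\ path step (b (tgt e)) s,
    last (b (tgt e)) s = c e (k0 e).+1 & forall d, d \in b (tgt e) :: s -> inR (tgt e) d].
  have hk := k0_bd e.
  have [|s] := @walk_of_fun (fun i => c e (3 * N - i)) (3 * N - (k0 e).+1).
    move=> i lti; rewrite step_sym.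
    have -> : 3 * N - i = (3 * N - i.+1).+1 by lia.
    by apply: c_step; lia.
  rewrite subn0 c_tgt => -[ps ls ms]; exists s; split=> //.
    by rewrite ls; congr c; lia.
  move=> d /ms[i le_i ->]; right; exists e, (3 * N - i); split=> //; lia.
have [s1 s1P] := fin_all_exists tail_walks.
have [s2 s2P] := fin_all_exists head_walks.
refine (inhabits (@GridModel G region b src tgt s1 s2 _ _ _ _ _ _ _ _)).
- by move=> v; rewrite filter_uniq ?undup_uniq.
- by move=> v w d /regionP rv /regionP rw; apply: inR_inj rv rw.
- exact: ends.
- by move=> e; have [] := s1P e.
- by move=> e; have [] := s2P e.
- by move=> e d de; apply/regionP; left; have [_ _] := s1P e; apply.
- by move=> e d de; apply/regionP; have [_ _] := s2P e; apply.
- move=> e; have [_ -> _] := s1P e; have [_ -> _] := s2P e.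
  by apply: c_step; have := k0_bd e; lia.
Qed.

End SampledDrawing.

(** * Compactness of arcs *)

Section Arcs.

Local Open Scope classical_set_scope.
Local Open Scope ring_scope.
Variable R : realType.
Implicit Types f g : R -> R * R.

Lemma within_continuous_ball f (K : set R) s (eps : R) :
  {within K, continuous f} -> K s -> 0 < eps ->
  \forall s' \near s, K s' -> ball (f s) eps (f s').
Proof.
move=> /subspace_continuousP/(_ s) fc Ks eps0.
exact: (fc Ks _ (nbhsx_ballx _ _ eps0)).
Qed.

Lemma disjoint_arcs_apart f g (K L : set R) : compact K -> compact L ->
  {within K, continuous f} -> {within L, continuous g} ->
  (forall s t, K s -> L t -> f s <> g t) ->
  \forall h \near 0^'+, forall s t, K s -> L t -> ~ ball (f s) h (g t).
Proof.
move=> cK cL fc gc fg.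
have clL : closed (g @` L).
  apply: compact_closed; last exact: continuous_compact.
  exact: norm_hausdorff.
have /compact_near_coveringP/near_covering_withinP covK := cK.
have : \forall h \near 0^'+, K `<=` (fun s => forall t, L t -> ~ ball (f s) h (g t)).
  apply: covK => s Ks.
  have : nbhs (f s) (~` (g @` L)).
    apply: open_nbhs_nbhs; split; first exact: closed_openC.
    by move=> [t Lt gt]; apply: (fg s t).
  move=> /nbhs_ballP[e /= e0 sube].
  have e20 : 0 < e / 2 by rewrite divr_gt0.
  near=> s' h => /= Ks' t Lt bst.
  apply: (sube (g t)); last by exists t.
  apply: (@ball_split _ _ (f s')).
    by move: Ks'; near: s'; exact: within_continuous_ball.
  apply: le_ball bst; near: h; exact: nbhs_right_ltW.
by apply: filterS => h sub s t Ks; apply: sub.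
Unshelve. all: by end_near. Qed.

Lemma arc_uniformly_continuous f (K : set R) (h : R) : compact K ->
  {within K, continuous f} -> 0 < h ->
  \forall d \near 0^'+, forall s t : R, K s -> K t -> `|s - t| < d ->
    ball (f s) h (f t).
Proof.
move=> cK fc h0; have /compact_near_coveringP/near_covering_withinP covK := cK.
have : \forall d \near 0^'+, K `<=` (fun s => forall t : R, K t -> `|s - t| < d ->
    ball (f s) h (f t)).
  apply: covK => s Ks; have h20 : 0 < h / 2 by rewrite divr_gt0.
  have /nbhs_ballP[e /= e0 sube] := within_continuous_ball fc Ks h20.
  have e20 : 0 < e / 2 by rewrite divr_gt0.
  near=> s' d => /= Ks' t Kt std.
  have ss' : ball s (e / 2) s' by near: s'; exact: nbhsx_ballx.
  apply: (@ball_split _ _ (f s)).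
    apply: ball_sym; apply: sube => //.
    by apply: le_ball ss'; lra.
  apply: sube => //; apply: (@ball_split _ _ s') => //.
  rewrite -ball_normE /ball_ /=; apply: (lt_le_trans std).
  near: d; exact: nbhs_right_ltW.
by apply: filterS => d sub s t Ks; apply: sub.
Unshelve. all: by end_near. Qed.
End Arcs.

(** * From plane drawings to grid models *)

Section PlanarGridModel.

Local Open Scope classical_set_scope.
Local Open Scope ring_scope.
Variable R : realType.

Lemma floor_close (h x y : R) : 0 < h -> `|x - y| < h ->
  `|Num.floor (x / h) - Num.floor (y / h)| <= 1.
Proof.
move=> h0; rewrite ltr_norml => /andP[xy1 xy2].
have /andP[fx1 fx2] := floor_itv (x / h); have /andP[fy1 fy2] := floor_itv (y / h).
have d1 : x / h - y / h < 1 by rewrite -mulrBl ltr_pdivrMr // mul1r.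
have d2 : -1 < x / h - y / h by rewrite -mulrBl ltr_pdivlMr // mulN1r.
have u1 : (Num.floor (x / h) - Num.floor (y / h))%:~R < 2%:~R :> R.
  by rewrite intrB; move: fx1 fy2 d1; rewrite intrD; lra.
have u2 : (-2)%:~R < (Num.floor (x / h) - Num.floor (y / h))%:~R :> R.
  by rewrite intrB; move: fx2 fy1 d2; rewrite intrD; lra.
rewrite !ltr_int in u1 u2; move: u1 u2.
by move: (Num.floor _) (Num.floor _) => a b; lia.
Qed.

Lemma floor_eq_close (h x y : R) : 0 < h -> Num.floor (x / h) = Num.floor (y / h) ->
  `|x - y| < h.
Proof.
move=> h0 fxy.
have /andP[fx1 fx2] := floor_itv (x / h); have /andP[fy1 fy2] := floor_itv (y / h).
rewrite fxy in fx1 fx2; rewrite intrD in fx2 fy2.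
have d1 : x / h - y / h < 1 by lra.
have d2 : -1 < x / h - y / h by lra.
rewrite -mulrBl ltr_pdivrMr // mul1r in d1.
rewrite -mulrBl ltr_pdivlMr // mulN1r in d2.
by rewrite ltr_norml d1 d2.
Qed.

Definition third (i : 'I_3) : set R := [set` `[i%:R / 3, i.+1%:R / 3]].

Definition third0 : 'I_3 := Ordinal (isT : 0 < 3)%N.
Definition third1 : 'I_3 := Ordinal (isT : 1 < 3)%N.
Definition third2 : 'I_3 := Ordinal (isT : 2 < 3)%N.

Lemma third_sub i : third i `<=` `[0, 1].
Proof.
move=> t; rewrite /third /= !in_itv /= => /andP[t1 t2]; apply/andP; split.
  by apply: le_trans t1; rewrite divr_ge0.
apply: le_trans t2 _; rewrite ler_pdivrMr // mul1r ler_nat.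
exact: ltn_ord.
Qed.

Lemma sample_third (N j : nat) (i : 'I_3) : (0 < N)%N -> (i * N <= j <= i.+1 * N)%N ->
  third i (j%:R / (3 * N)%:R).
Proof.
move=> N0 /andP[j1 j2]; rewrite /third /= in_itv /=.
have N30 : 0 < (3 * N)%:R :> R by rewrite ltr0n muln_gt0.
rewrite ler_pdivlMr // mulrAC ler_pdivrMr // ler_pdivrMr // mulrAC ler_pdivlMr //.
rewrite -!natrM !ler_nat; apply/andP; split; lia.
Qed.

(** The sample k of e is the grid cell of the point whose first coordinate is
taken at time uphalf k and whose second one at time k./2, so that only one
coordinate changes in a step. *)
Lemma planar_grid_model (G : sgraph) : planar R G -> inhabited (grid_model G).
Proof.
move=> [p [g [pinj arcs endp noV noX]]].
have [src [tgt ends]] : exists src tgt : edge G -> G, forall e,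
    [/\ val e = [set src e; tgt e]%SET, g e 0 = p (src e) & g e 1 = p (tgt e)].
  by have [src /fin_all_exists[tgt ends]] := fin_all_exists endp; exists src, tgt.
have gc e : {within `[0, 1], continuous (g e)} by have [] := arcs e.
pose at_end e (s : R) u := s = 0 /\ u = src e \/ s = 1 /\ u = tgt e.
have at_endP e s u : at_end e s u -> g e s = p u.
  by move=> [[-> ->]|[-> ->]]; have [] := ends e.
pose I : set R := [set` `[0, 1]].
have meet e f s t : I s -> I t -> g e s = g f t ->
    e = f /\ s = t \/ exists u, at_end e s u /\ at_end f t u.
  have interior e' (t' : R) : I t' -> (t' \in `]0, 1[)%R \/ exists u, at_end e' t' u.
    rewrite /I /= !in_itv /= => /andP[]; rewrite !le_eqVlt.
    move=> /orP[/eqP<- _|t0 /orP[/eqP->|t1]].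
    - by right; exists (src e'); left.
    - by right; exists (tgt e'); right.
    - by left; rewrite t0 t1.
  move=> Is It st; have [sI|[u su]] := interior e s Is.
    have [tI|[v tv]] := interior f t It; last first.
      by case: (noV e v s sI); rewrite st (at_endP f t v tv).
    left; have [ef|ef] := eqVneq e f; last by case: (noX e f ef s t sI tI).
    split=> //; have [_ ginj] := arcs e; apply: ginj; rewrite ?inE //.
    by rewrite st ef.
  have [tI|[v tv]] := interior f t It.
    by case: (noV f u t tI); rewrite -st (at_endP e s u su).
  right; exists u; split=> //; suff -> : u = v by [].
  by apply: pinj; rewrite -(at_endP e s u su) -(at_endP f t v tv).
have [eta [eta0 apart]] : exists eta : R, 0 < eta /\ forall e f i j,
    (forall s t, third i s -> third j t -> g e s <> g f t) ->
    forall s t, third i s -> third j t -> ~ ball (g e s) eta (g f t).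
  suff near_apart : \forall eta \near (0 : R)^'+, forall e f i j,
      (forall s t, third i s -> third j t -> g e s <> g f t) ->
      forall s t, third i s -> third j t -> ~ ball (g e s) eta (g f t).
    have [eta []] := filter_ex (filterI (nbhs_right_gt (0 : R)) near_apart).
    by exists eta.
  apply: filter_forall => e; apply: filter_forall => f.
  apply: filter_forall => i; apply: filter_forall => j.
  have [disj|meets] := pselect (forall s t, third i s -> third j t -> g e s <> g f t).
    apply: (filterS _ (disjoint_arcs_apart _ _ _ _ disj)); first by move=> eta.
    - exact: segment_compact.
    - exact: segment_compact.
    - by apply: continuous_subspaceW (gc e); exact: third_sub.
    - by apply: continuous_subspaceW (gc f); exact: third_sub.
  by apply: filterE => eta /meets.
(* Two samples in the same cell of side h come from points at distance less than
   3 * h: at most h inside the cell, and at most h on each arc for the delay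
   between the two coordinates. *)
pose h := eta / 3.
have h0 : 0 < h by rewrite divr_gt0.
have [d [d0 unif]] : exists d : R, 0 < d /\ forall e s t, I s -> I t -> `|s - t| < d ->
    ball (g e s) h (g e t).
  suff near_unif : \forall d \near (0 : R)^'+, forall e s t, I s -> I t -> `|s - t| < d ->
      ball (g e s) h (g e t).
    have [d []] := filter_ex (filterI (nbhs_right_gt (0 : R)) near_unif).
    by exists d.
  apply: filter_forall => e; apply: arc_uniformly_continuous => //.
  exact: segment_compact.
have [n ltnd] : exists n : nat, n.+1%:R^-1 < d.
  by have [n _ /(_ n (leqnn n))] := near_infty_natSinv_lt (PosNum d0); exists n.
pose N := n.+1.
have N30 : 0 < (3 * N)%:R :> R by rewrite ltr0n.
pose T j : R := j%:R / (3 * N)%:R.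
have TI j : (j <= 3 * N)%N -> I (T j).
  move=> le_j; rewrite /I /= in_itv /= divr_ge0 ?ler0n //=.
  by rewrite ler_pdivrMr // mul1r ler_nat.
have TS j : `|T j - T j.+1| < d.
  rewrite /T -mulrBl -natr1 opprD addNKr mulN1r normrN gtr0_norm ?invr_gt0 //.
  apply: le_lt_trans ltnd; rewrite lef_pV2 ?posrE ?ltr0n // ler_nat /N; lia.
pose X e j := Num.floor ((g e (T j)).1 / h).
pose Y e j := Num.floor ((g e (T j)).2 / h).
pose c e k : cell := (X e (uphalf k), Y e k./2).
pose b v : cell := (Num.floor ((p v).1 / h), Num.floor ((p v).2 / h)).
have near_samples e j : (j < 3 * N)%N -> ball (g e (T j)) h (g e (T j.+1)).
  by move=> lt_j; apply: unif; rewrite ?TS //; apply: TI; lia.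
have close e f k l : (k <= 3 * (2 * N))%N -> (l <= 3 * (2 * N))%N -> c e k = c f l ->
    ball (g e (T k./2)) eta (g f (T l./2)).
  move=> le_k le_l [Xkl Ykl].
  have drift e' k' : (k' <= 3 * (2 * N))%N ->
      `|(g e' (T k'./2)).1 - (g e' (T (uphalf k'))).1| < h.
    move=> le_k'; rewrite uphalf_half; case: (boolP (odd k')) => [oddk|_]; last first.
      by rewrite add0n subrr normr0.
    have [|+ _] := near_samples e' k'./2; last by rewrite -ball_normE.
    by have := odd_double_half k'; rewrite oddk; lia.
  have hk := drift e k le_k; have hl := drift f l le_l.
  have hx := floor_eq_close h0 Xkl; have hy := floor_eq_close h0 Ykl.
  have etah : eta = h + h + h by rewrite /h; field.
  split; rewrite -ball_normE /ball_ /=; last by apply: lt_trans hy _; lra.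
  move: hk hl hx; rewrite !ltr_norml; lra.
have in_third e v k : near_end src tgt (2 * N) e v k ->
    (third third0 (T k./2) /\ v = src e \/ third third2 (T k./2) /\ v = tgt e)
    /\ (k <= 3 * (2 * N))%N.
  move=> /orP[]/andP[hk /eqP vE]; split; try lia.
    by left; split=> //; apply: sample_third => //=; lia.
  by right; split=> //; apply: sample_third => //=; lia.
have in_mid k : (2 * N <= k <= 2 * (2 * N))%N ->
    third third1 (T k./2) /\ (k <= 3 * (2 * N))%N.
  by move=> hk; split; [apply: sample_third => //=; lia|lia].
have no_mid_end e s u : third third1 s -> at_end e s u -> False.
  by rewrite /third /= in_itv /= => sI [[s0 _]|[s1 _]]; lra.
apply: (@grid_model_of_samples G src tgt b (2 * N) c).
- by move=> e; have [] := ends e.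
- move=> e; rewrite /c /X /Y /= /T mul0r; have [_ -> _] := ends e.
  by [].
- move=> e; have [_ _ g1] := ends e.
  have -> : (3 * (2 * N) = (3 * N).*2)%N by lia.
  by rewrite /c /X /Y uphalf_double doubleK /T divff ?gt_eqF // g1.
- move=> e k lt_k; rewrite /step /c /=.
  have lt_j : (k./2 < 3 * N)%N by have := odd_double_half k; lia.
  have close_x := floor_close h0 (near_samples e _ lt_j).1.
  have close_y := floor_close h0 (near_samples e _ lt_j).2.
  rewrite -/(X e _) -/(X e _) in close_x; rewrite -/(Y e _) -/(Y e _) in close_y.
  rewrite !uphalf_half; case: (odd k) => /=; rewrite ?add0n ?add1n subrr normr0.
    by rewrite add0r.
  by rewrite addr0.
- move=> e f v w k l /in_third[hv le_k] /in_third[hw le_l] vw ekl.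
  have := close e f k l le_k le_l ekl.
  have end0 e' u s : third third0 s -> at_end e' s u -> u = src e'.
    by rewrite /third /= in_itv /= => sI [[_ ->]|[s1 _]] //; exfalso; lra.
  have end2 e' u s : third third2 s -> at_end e' s u -> u = tgt e'.
    by rewrite /third /= in_itv /= => sI [[s0 _]|[_ ->]] //; exfalso; lra.
  have apart02 (s : R) : third third0 s -> third third2 s -> False.
    by rewrite /third /= !in_itv /=; lra.
  case: hv => -[tk vE]; case: hw => -[tl wE]; apply: apart tk tl => s t ts tt st;
    have [[ef sst]|[u [us ut]]] := meet _ _ _ _ (third_sub ts) (third_sub tt) st;
    apply: vw; rewrite vE wE ?ef //.
  + by rewrite -(end0 _ _ _ ts us) -(end0 _ _ _ tt ut).
  + by case: (apart02 s); rewrite // sst.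
  + by rewrite -(end0 _ _ _ ts us) -(end2 _ _ _ tt ut).
  + by case: (apart02 s); rewrite // sst.
  + by rewrite -(end2 _ _ _ ts us) -(end0 _ _ _ tt ut).
  + by rewrite -(end2 _ _ _ ts us) -(end2 _ _ _ tt ut).
- move=> e f k l /in_mid[tk le_k] /in_mid[tl le_l] ef ekl.
  have := close e f k l le_k le_l ekl.
  apply: apart tk tl => s t ts tt st.
  have [[//]|[u [us _]]] := meet _ _ _ _ (third_sub ts) (third_sub tt) st.
  exact: no_mid_end ts us.
- move=> e f w k l /in_mid[tk le_k] /in_third[hw le_l] we ekl.
  have := close e f k l le_k le_l ekl.
  have wf : w \in val f.
    have [-> _ _] := ends f; rewrite !inE.
    by case: hw => -[_ ->]; rewrite eqxx ?orbT.
  case: hw => -[tl _]; apply: apart tk tl => s t ts tt st;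
    have [[ef _]|[u [us _]]] := meet _ _ _ _ (third_sub ts) (third_sub tt) st;
    by [rewrite ef wf in we | apply: no_mid_end ts us].
Qed.

End PlanarGridModel.

(** * List edge chromatic number *)

Lemma deg_neighbours (G : sgraph) (x : G) : deg [set: edge G] x = #|[set y | adj x y]|.
Proof.
rewrite /deg -(card_in_imset (f := fun e => other e x)); last first.
  move=> e f; rewrite !inE => xe xf; exact: edge_inj_other.
apply: eq_card => y; rewrite inE; apply/imsetP/idP => [[e]|xy].
  rewrite !inE => /= xe ->; have [xo _] := otherP xe.
  exact: edge_adj xo xe (mem_other xe).
have [e ve] := edge_of_adj xy; have xe : x \in val e by rewrite ve !inE eqxx.
exists e; first by rewrite !inE.
have [xo vo] := otherP xe; have : y \in val e by rewrite ve !inE eqxx orbT.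
rewrite vo !inE => /orP[/eqP yx|/eqP//].
by move: xy; rewrite yx adj_irrefl.
Qed.

(** A minimal set of edges that cannot be coloured contradicts the two opposite
bounds given by [discharging] and [grid_model_bound]. *)
Lemma planar_edge_choosable (R : realType) (G : sgraph) (D : nat) :
  planar R G -> kite_free G -> 9 <= D -> max_degree G <= D -> edge_choosable G D.
Proof.
move=> /planar_grid_model[m] nokite D9 maxD C L leL.
have leD (A : {set edge G}) (x : G) : deg A x <= D.
  apply: leq_trans (degS x (subsetT A)) _; rewrite deg_neighbours.
  apply: leq_trans maxD; exact: leq_bigmax.
suff col A : list_colourable L A.
  have [c [cL cP]] := col [set: edge G]; exists c; split=> [e|e f x].
    by apply: cL; rewrite inE.
  by apply: cP; rewrite inE.
have [k] := ubnP #|A|; elim: k A => // k IHk A leA.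
apply: contrapT => ncol.
have critA : critical L A.
  split=> // B BA; apply: IHk; apply: leq_trans (proper_card BA) _.
  by rewrite -ltnS.
have A0 : A != finset.set0.
  apply/eqP => A0; apply: ncol.
  have L0 e : exists a, a \in L e.
    by apply/fset0Pn; rewrite -cardfs_gt0; apply: leq_trans (leL e); apply: leq_trans D9.
  have [c cL] := fin_all_exists L0; exists c; split=> // e f x.
  by rewrite A0 inE.
have := grid_model_bound m A0.
have := discharging nokite D9 leL (leD A) critA.
by lia.
Qed.

Lemma edge_choosable_max_degree (G : sgraph) (k : nat) :
  edge_choosable G k -> max_degree G <= k.
Proof.
move=> choos; apply/bigmax_leqP => x _.
pose S := [fset i in iota 0 k]%fset.
have [|c [cS cP]] := choos nat (fun=> S).
  by move=> e; rewrite card_fseq undup_id ?iota_uniq // size_iota.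
have ltc e : c e < k.
  by have := cS e; rewrite in_fset /= mem_iota.
rewrite -deg_neighbours /deg -[leqRHS]card_ord.
rewrite -(card_in_imset (f := fun e => Ordinal (ltc e))) ?max_card // => e f.
rewrite !inE /= => xe xf /(congr1 val)/= cef; apply/eqP/negPn/negP => ef.
exact: cP ef xe xf cef.
Qed.

Theorem theorem13 (R : realType) (G : sgraph) (Gplanar : planar R G)
  (Gkite : kite_free G) (Gdeg : 9 <= max_degree G) :
  list_edge_chromatic_number G = max_degree G.
Proof.
rewrite /list_edge_chromatic_number; case: ex_minnP => k /asboolP choos min_k.
apply/eqP; rewrite eqn_leq edge_choosable_max_degree // andbT.
by apply: min_k; apply/asboolP; apply: planar_edge_choosable Gplanar Gkite Gdeg _.
Qed.
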